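(* For all $d\ge2$ (and real parameters $a,b$) one has $$\varepsilon_k(\mathbf W^{a,b}_\infty,L_1)\gg k^{-a}(\log k)^{(d-1)(a+b)-1/2},\qquad k\ge2.$$
   Context: Functions are complex-valued and $2\pi$-periodic in each of $d$ variables; $L_p=L_p(\mathbb T^d)$ with respect to the normalized measure $(2\pi)^{-d}d\mathbf x$; $\hat f(\mathbf k)=(2\pi)^{-d}\int_{\mathbb T^d}f(\mathbf x)e^{-i(\mathbf k,\mathbf x)}d\mathbf x$. For $\mathbf s\in\mathbb Z_+^d$ (nonnegative integer coordinates) let $\rho(\mathbf s)=\{\mathbf k\in\mathbb Z^d:[2^{s_j-1}]\le|k_j|<2^{s_j},\ j=1,\dots,d\}$, where $[\cdot]$ is the integer part, and $\|\mathbf s\|_1=s_1+\dots+s_d$. For $f\in L_1$ let $\delta_{\mathbf s}(f)=\sum_{\mathbf k\in\rho(\mathbf s)}\hat f(\mathbf k)e^{i(\mathbf k,\mathbf x)}$ and $f_l=\sum_{\|\mathbf s\|_1=l}\delta_{\mathbf s}(f)$, $l=0,1,2,\dots$. Class: $\mathbf W^{a,b}_q=\{f\in L_1:\|f_l\|_q\le 2^{-al}(\bar l)^{(d-1)b}\text{ for all } l\ge0\}$, $\bar l=\max(l,1)$. Entropy numbers: for a subset $A$ of a Banach space $X$, $\varepsilon_k(A,X)=\inf\{\varepsilon:\exists y^1,\dots,y^{2^k}\in X,\ A\subseteq\bigcup_{j=1}^{2^k}B_X(y^j,\varepsilon)\}$ ($\inf\emptyset=+\infty$), where $B_X(y,r)=\{x\in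 X:\|x-y\|\le r\}$. $A_k\gg B_k$ means $A_k\ge cB_k$ for all $k$ with $c>0$ independent of $k$ (it may depend on the other parameters). *)

(* Defs.v *)
From HB Require Import structures.
From mathcomp Require Import all_boot all_order all_algebra.
From mathcomp Require Import all_classical all_reals all_analysis.
From mathcomp Require Import complex.

Set Implicit Arguments.
Unset Strict Implicit.
Unset Printing Implicit Defensive.

Import Order.TTheory GRing.Theory Num.Theory.
Import numFieldNormedType.Exports.

Local Open Scope complex_scope.
Local Open Scope classical_set_scope.
Local Open Scope ring_scope.

(* A function on the torus is a function on R^d that is 2 pi-periodic in each
   variable; R^d is the type of d-tuples with the product sigma-algebra. *)
Notation Rd R d := (d.-tuple (measurableTypeR R)).

Section torus_measure.
Context {R : realType}.

Lemma twopi_gt0 : 0 < 2 * pi :> R.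
Proof. by rewrite mulr_gt0 ?pi_gt0. Qed.

Definition tcons d (p : measurableTypeR R * Rd R d) : Rd R d.+1 :=
  [the d.+1.-tuple _ of p.1 :: p.2].

Lemma measurable_tcons d : measurable_fun [set: _] (@tcons d).
Proof. exact: measurable_cons. Qed.

HB.instance Definition _ d :=
  isMeasurableFun.Build _ _ _ _ (@tcons d) (@measurable_tcons d).

(* The normalized measure (2 pi)^-d dx on the cube [0, 2 pi]^d, as the d-fold
   product of the normalized Lebesgue measure on [0, 2 pi]. *)
Fixpoint torus_measure (d : nat) : probability (Rd R d) R :=
  match d with
  | 0 => \d_ ([tuple] : Rd R 0)
  | d'.+1 =>
      distribution (uniform_prob twopi_gt0 \x torus_measure d')%E
        (@tcons d' : {mfun _ >-> _})
  end.

End torus_measure.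

Section function_spaces.
Context {R : realType} (d : nat).
Implicit Types (f : Rd R d -> R[i]) (p q : \bar R).
Local Notation mu := (@torus_measure R d).

Definition torus_periodic f := forall (x : Rd R d) (j : 'I_d),
  f [tuple tnth x i + (if i == j then 2 * pi else 0) | i < d] = f x.

Definition cmeasurable f :=
  measurable_fun [set: Rd R d] (fun x => complex.Re (f x)) /\
  measurable_fun [set: Rd R d] (fun x => complex.Im (f x)).

Definition cnorm p f : \bar R := 'N[mu]_p[EFin \o (fun x => Normc.normc (f x))]%E.

Definition Lp p : set (Rd R d -> R[i]) :=
  [set f | [/\ torus_periodic f, cmeasurable f & (cnorm p f < +oo)%E]].

Definition cintegral f : R[i] :=
  (\int[mu]_x complex.Re (f x)) +i* (\int[mu]_x complex.Im (f x)).

Definition dotp (k : d.-tuple int) (x : Rd R d) : R :=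
  \sum_(j < d) (tnth k j)%:~R * (tnth x j : R).

Definition expi (t : R) : R[i] := cos t +i* sin t.

Definition fourier_coef f (k : d.-tuple int) : R[i] :=
  cintegral (fun x => f x * expi (- dotp k x)).

(* 2 ^ s %/ 2 is the integer part of 2^(s-1), i.e. 0 for s = 0. *)
Definition rho (s : d.-tuple nat) : set (d.-tuple int) :=
  [set k | forall j : 'I_d,
     (2 ^ tnth s j %/ 2 <= `|tnth k j| < 2 ^ tnth s j)%N].

Definition delta (s : d.-tuple nat) f : Rd R d -> R[i] := fun x =>
  \sum_(k \in rho s) fourier_coef f k * expi (dotp k x).

Definition layer (l : nat) f : Rd R d -> R[i] := fun x =>
  \sum_(s \in [set s : d.-tuple nat | (\sum_(j < d) tnth s j)%N = l])
     delta s f x.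

Definition Wclass (a b : R) q : set (Rd R d -> R[i]) :=
  [set f | Lp 1 f /\ forall l : nat,
     (cnorm q (layer l f) <=
      (2 `^ (- (a * l%:R)) * (maxn l 1)%:R `^ (d.-1%:R * b))%:E)%E].

End function_spaces.

(* Entropy numbers in the space X (a set of elements of V) with the norm N,
   +oo when no finite radius works. N may be a seminorm: covering a set of
   functions or the set of their classes modulo null functions requires the
   same radii. *)
Definition entropy_number {R : realType} {V : zmodType}
    (X : set V) (N : V -> \bar R) (A : set V) (k : nat) : \bar R :=
  ereal_inf [set e%:E | e in [set e : R | 0 <= e /\
    exists y : 'I_(2 ^ k) -> V, (forall j, X (y j)) /\
      A `<=` \bigcup_j [set x | X x /\ (N (x - y j)%R <= e%:E)%E]]].

(* Main.v *)
Require Import Defs.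
From mathcomp Require Import all_boot all_order all_algebra.
From mathcomp Require Import all_classical all_reals all_analysis.
From mathcomp Require Import complex.
From mathcomp Require Import measurable_realfun zify ring lra.

Set Implicit Arguments.
Unset Strict Implicit.
Unset Printing Implicit Defensive.

Import Order.TTheory GRing.Theory Num.Theory.
Import numFieldNormedType.Exports.

Local Open Scope ring_scope.

(* Random signs. Let L be the set of frequencies with nonnegative coordinates
   in the n-th layer, N = #|L| >> 2^n n^(d-1), and f_s = sum_(k in L) s_k e^(i(k,x))
   for a sign vector s. For at least half of the sign vectors both
   |f_s|_oo << sqrt (N n) (subgaussian tails on a grid of 2^O(n) points, then a
   Lipschitz estimate) and |f_s|_4^4 << N^2, so that 2^(-an) n^((d-1)b) f_s / sqrt (N n)
   is, up to a constant, in the class. If 2^k balls cover the class and N >= 64 k,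
   the pigeonhole principle and the subgaussian tail provide two such vectors s, s'
   in the same ball whose scalar product is less than N / 2. Then
   |f_s - f_s'|_2^2 >= N, and the bound on the fourth moments turns this into
   |f_s - f_s'|_1 >> sqrt N. Hence the radius is >> 2^(-an) n^((d-1)b - 1/2), and
   n is chosen with 2^n n^(d-1) of the order of k. *)

(** * Rademacher sums *)

Section rademacher.
Context {R : realType} {I : finType}.
Implicit Types (a : I -> R) (s : {ffun I -> bool}).

Definition sgb (b : bool) : R := (-1) ^+ b.

Definition radsum a s : R := \sum_i sgb (s i) * a i.

Lemma sgbM (b : bool) : sgb b * sgb b = 1.
Proof. by case: b; rewrite /sgb /= ?expr1 ?expr0 ?mulrNN mulr1. Qed.

Lemma normr_sgb (b : bool) : `|sgb b| = 1.
Proof. by rewrite /sgb normr_sign. Qed.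

(** Invert [1 - x <= expR (- x)]; the quadratic dominates 1 / (1 - x) because (1 + x + 2x^2)(1 - x)
    = 1 + x^2 (1 - 2x) and x <= 1/2. *)
Lemma expR_le_quad (x : R) : `|x| <= 2^-1 -> expR x <= 1 + x + 2 * x ^+ 2.
Proof.
move=> x2; have [x1 x2'] : x <= 2^-1 /\ - 2^-1 <= x by move: x2; rewrite ler_norml => /andP[].
have e : 1 - x <= expR (- x) by exact: expR_ge1Dx.
have h : 0 < 1 - x by lra.
have : expR x <= (1 - x)^-1.
  by rewrite -[x in expR x]opprK expRN lef_pV2 ?posrE ?expR_gt0.
move/le_trans; apply.
rewrite -(ler_pM2r h) mulVf ?gt_eqF//.
have hx : 0 <= x ^+ 2 by exact: sqr_ge0.
have -> : (1 + x + 2 * x ^+ 2) * (1 - x) = 1 + x ^+ 2 * (1 - 2 * x) by ring.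
rewrite lerDl mulr_ge0//; lra.
Qed.

(** In the sum of the two quadratic bounds the linear terms cancel; for |x| > 1/2 one has |x| <=
    2x^2 directly. *)
Lemma cosh_le (x : R) : expR x + expR (- x) <= 2 * expR (2 * x ^+ 2).
Proof.
have [x2|x2] := leP `|x| 2^-1.
  have h1 := expR_le_quad x2.
  have h2 : expR (- x) <= 1 + (- x) + 2 * (- x) ^+ 2 by apply: expR_le_quad; rewrite normrN.
  have h3 := expR_ge1Dx (2 * x ^+ 2).
  rewrite sqrrN in h2; lra.
have h : `|x| <= 2 * x ^+ 2.
  by rewrite -real_normK ?num_real//; nra.
have h1 : expR x <= expR (2 * x ^+ 2).
  by rewrite ler_expR; apply: le_trans h; exact: ler_norm.
have h2 : expR (- x) <= expR (2 * x ^+ 2).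
  by rewrite ler_expR; apply: le_trans h; rewrite -normrN; exact: ler_norm.
lra.
Qed.

(** Independence of the signs: the sum over all sign vectors of a product is the product of two-term
    sums, each at most 2 exp (2 a_i^2). *)
Lemma rad_mgf a :
  \sum_s expR (radsum a s) <= 2 ^+ #|I| * expR (2 * \sum_i a i ^+ 2).
Proof.
under eq_bigr do rewrite /radsum expR_sum.
rewrite -(bigA_distr_bigA (fun i b => expR (sgb b * a i))) /=.
rewrite mulr_sumr expR_sum.
rewrite -[2 ^+ _](prodr_const I) -big_split /=.
apply: ler_prod => i _; rewrite big_bool /= /sgb expr1 expr0 mulN1r mul1r addrC cosh_le andbT.
by rewrite addr_ge0 ?expR_ge0.
Qed.

Lemma radsumZ c a s : radsum (fun i => c * a i) s = c * radsum a s.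
Proof. by rewrite /radsum mulr_sumr; apply: eq_bigr => i _; rewrite mulrCA. Qed.

Lemma rad_tail a (t : R) : (0 < #|I|)%N -> (forall i, `|a i| <= 1) -> 0 <= t ->
  #|[set s | t <= radsum a s]|%:R <= 2 ^+ #|I| * expR (- (t ^+ 2 / (8 * #|I|%:R))) :> R.
Proof.
move=> I0 a1 t0; set N : R := #|I|%:R; have N0 : 0 < N by rewrite ltr0n.
(* Chernoff's method: this l minimizes 2 N l^2 - l t, with minimum - t^2 / (8 N). *)
pose l := t / (4 * N); have l0 : 0 <= l by rewrite divr_ge0// mulr_ge0// ltW.
have h := rad_mgf (fun i => l * a i).
have h2 : \sum_i (l * a i) ^+ 2 <= N * l ^+ 2.
  rewrite /N mulr_natl -sumr_const; apply: ler_sum => i _.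
  rewrite exprMn -[leRHS]mulr1 ler_wpM2l ?sqr_ge0//.
  by rewrite -real_normK ?num_real// exprn_ile1.
have h3 : #|[set s | t <= radsum a s]|%:R * expR (l * t) <=
    \sum_s expR (radsum (fun i => l * a i) s).
  rewrite mulr_natl -sumr_const [leRHS](bigID (mem [set s | t <= radsum a s]))/=.
  rewrite -[leLHS]addr0 lerD//; last by apply: sumr_ge0 => s _; exact: expR_ge0.
  apply: ler_sum => s; rewrite inE => ts.
  by rewrite ler_expR radsumZ ler_wpM2l.
have h4 : #|[set s | t <= radsum a s]|%:R * expR (l * t) <=
    2 ^+ #|I| * expR (2 * (N * l ^+ 2)).
  apply: (le_trans h3); apply: (le_trans h); rewrite ler_wpM2l ?exprn_ge0//.
  by rewrite ler_expR ler_wpM2l.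
have -> : - (t ^+ 2 / (8 * N)) = 2 * (N * l ^+ 2) - l * t.
  by rewrite /l; field; rewrite gt_eqF.
by rewrite expRD expRN mulrA ler_pdivlMr ?expR_gt0.
Qed.

(** For x >= 0 this is the term x^4 / 4! of the exponential series; the second exponential makes the
    bound even in x. *)
Lemma pow4_le_expR (x : R) : x ^+ 4 <= 24 * (expR x + expR (- x)).
Proof.
wlog x0 : x / 0 <= x => [hw|].
  have [/hw//|x0] := leP 0 x.
  have := hw (- x); rewrite opprK oppr_ge0 (ltW x0) => /(_ isT).
  by rewrite addrC; congr (_ <= _); ring.
have := expR_ge1Dxn 3 x0; rewrite (_ : (4`!)%N = 24%N)// => h.
have := expR_ge0 (- x); lra.
Qed.

(** At scale 1 / sqrt N the exponential moments, normalized by 2^N, are at most [expR 2], and they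
    dominate the fourth moment; 48 is 24 for each sign of the exponent. *)
Lemma rad_four a : (0 < #|I|)%N -> (forall i, `|a i| <= 1) ->
  \sum_s (radsum a s) ^+ 4 <= 48 * expR 2 * #|I|%:R ^+ 2 * 2 ^+ #|I|.
Proof.
move=> I0 a1; set N : R := #|I|%:R; have N0 : 0 < N by rewrite ltr0n.
pose l := (Num.sqrt N)^-1.
have lN : l ^+ 2 = N^-1 by rewrite /l exprVn sqr_sqrtr// ltW.
have h2 (c : R) : c ^+ 2 = N^-1 -> \sum_s expR (radsum (fun i => c * a i) s) <= 2 ^+ #|I| * expR 2.
  move=> cN; apply: (le_trans (rad_mgf _)); rewrite ler_wpM2l ?exprn_ge0//.
  rewrite ler_expR -[leRHS]mulr1 ler_wpM2l//.
  apply: (@le_trans _ _ (\sum_(i : I) N^-1)).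
    apply: ler_sum => i _; rewrite exprMn cN -[leRHS]mulr1 ler_wpM2l ?invr_ge0 ?(ltW N0)//.
    by rewrite -real_normK ?num_real// exprn_ile1.
  by rewrite sumr_const -[_ *+ _]mulr_natr mulVf// gt_eqF.
have step s : radsum a s ^+ 4 <= N ^+ 2 * 24 *
    (expR (radsum (fun i => l * a i) s) + expR (radsum (fun i => - l * a i) s)).
  rewrite !radsumZ mulNr -mulrA; set y := l * _.
  have -> : radsum a s ^+ 4 = N ^+ 2 * y ^+ 4.
    have -> : y ^+ 4 = (l ^+ 2) ^+ 2 * radsum a s ^+ 4 by rewrite /y; ring.
    by rewrite lN; field; rewrite gt_eqF.
  by rewrite ler_wpM2l ?sqr_ge0// pow4_le_expR.
apply: (le_trans (ler_sum _ (fun s _ => step s))).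
rewrite -mulr_sumr big_split /=.
have := h2 _ lN; have := h2 (- l); rewrite sqrrN => /(_ lN).
set A := \sum_s _; set B := \sum_s _ => hA hB.
have -> : 48 * expR 2 * N ^+ 2 * 2 ^+ #|I| = N ^+ 2 * 24 * (2 ^+ #|I| * expR 2 + 2 ^+ #|I| * expR 2) by ring.
by rewrite ler_wpM2l ?mulr_ge0 ?sqr_ge0// lerD.
Qed.
End rademacher.

(** * Integrals of cosines over the torus *)

Section trigonometric_integrals.
Context {R : realType}.

Lemma cos_lip (x y : R) : `|cos x - cos y| <= `|x - y|.
Proof.
wlog xy : x y / y < x => [hw|].
  case: (ltgtP x y) => [xy|xy|->]; last by rewrite !subrr.
    by rewrite distrC [leRHS]distrC; exact: hw.
  exact: hw.
have dcos z : z \in `]y, x[%R -> is_derive z 1 cos (- sin z :> R).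
  by move=> _; exact: is_derive_cos.
have [|c _ ->] := MVT xy dcos.
  by apply: continuous_subspaceT => z; exact: continuous_cos.
rewrite normrM normrN -[leRHS]mul1r ler_wpM2r//.
by rewrite ler_norml sin_geN1 sin_le1.
Qed.

Lemma cos_period_nat (x : R) (n : nat) : cos (x + 2 * pi * n%:R) = cos x.
Proof.
by rewrite mulr_natr mulr_natl; exact: (periodicn (@cosD2pi R)).
Qed.

Lemma cos_period (x : R) (n : int) : cos (x + 2 * pi * n%:~R) = cos x.
Proof.
case: n => n; first exact: cos_period_nat.
by rewrite -(cos_period_nat _ n.+1) NegzE mulrNz mulrN subrK.
Qed.

Lemma sin_cos (x : R) : sin x = cos (x - pi / 2).
Proof. by rewrite cosBpihalf. Qed.

Lemma measurable_cos : measurable_fun [set: R] (cos : R -> R).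
Proof. by apply: continuous_measurable_fun => x; exact: continuous_cos. Qed.

Lemma measurable_dotp d (k : d.-tuple int) :
  measurable_fun [set: Rd R d] (@dotp R d k).
Proof.
rewrite /dotp; apply: measurable_sum => j.
apply: measurable_funM; first exact: measurable_cst.
exact: measurable_tnth.
Qed.

(** The added 1 keeps the integrand nonnegative, for the integral against the uniform law and later
    for Tonelli. The phase c will carry the other variables. *)
Lemma integral_cos_cell (k : int) (c : R) :
  (\int[uniform_prob (@twopi_gt0 R)]_x (1 + cos (k%:~R * x + c))%:E =
    (1 + (k == 0)%:R * cos c)%:E)%E.
Proof.
have cnt : continuous (fun x : R => 1 + cos (k%:~R * x + c)).
  move=> x; apply: cvgD; first exact: cvg_cst.
  apply: (@continuous_comp _ _ _ (fun x : R => k%:~R * x + c) cos); last exact: continuous_cos.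
  by apply: cvgD; [apply: cvgMr; exact: cvg_id|exact: cvg_cst].
rewrite integral_uniform; last 2 first.
- by apply/measurable_EFinP; exact: continuous_measurable_fun.
- by move=> x; rewrite lee_fin -lerBlDl add0r; exact: cos_geN1.
have p2 := @twopi_gt0 R.
have p2n : (2 * pi : R) != 0 by rewrite gt_eqF.
have [->|k0] := eqVneq k 0.
  under eq_integral do rewrite mulr0z mul0r add0r.
  rewrite integral_cst//= lebesgue_measure_itv/= lte_fin p2 -EFinB -!EFinM; congr (_%:E).
  by rewrite !subr0 mul1r mulrCA mulVf// mulr1.
have k0' : (k%:~R : R) != 0 by rewrite intr_eq0.
pose F (x : R) := x + (k%:~R)^-1 * sin (k%:~R * x + c).
have dF (x : R) : is_derive x 1 F (1 + cos (k%:~R * x + c)).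
  rewrite /F; apply: is_derive_eq.
  by rewrite /GRing.scale /= mulr1 addr0 [_ * k%:~R]mulrC mulKf.
rewrite (@continuous_FTC2 _ _ F)//; last 3 first.
- exact: continuous_subspaceT.
- split.
  + by move=> x _; exact: ex_derive.
  + by apply: cvg_at_right_filter; apply/differentiable_continuous/derivable1_diffP/ex_derive.
  + by apply: cvg_at_left_filter; apply/differentiable_continuous/derivable1_diffP/ex_derive.
- by move=> x _; rewrite derive1E derive_val.
rewrite -EFinB -EFinM; congr (_%:E).
rewrite /F mulr0 add0r addrAC -addrA subr0.
have -> : sin (k%:~R * (2 * pi) + c) = sin c.
  by rewrite !sin_cos -[in RHS](cos_period _ k); congr cos; ring.
by rewrite mul0r add0r addr0 addNr addr0 mulVf.
Qed.

(** Induction on d: the first coordinate is integrated out, the others being absorbed in the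
    phase. *)
Lemma integral_cos_tonelli d (k : d.-tuple int) (c : R) :
  (\int[@torus_measure R d]_x (1 + cos (dotp k x + c))%:E =
    (1 + (k == nseq_tuple d 0)%:R * cos c)%:E)%E.
Proof.
have mf d' (k' : d'.-tuple int) (c' : R) :
    measurable_fun [set: Rd R d'] (fun x => (1 + cos (dotp k' x + c'))%:E).
  apply/measurable_EFinP/measurable_funD; first exact: measurable_cst.
  apply: (@measurableT_comp _ _ _ _ _ _ cos); first exact: measurable_cos.
  by apply: measurable_funD; [exact: measurable_dotp|exact: measurable_cst].
have f0 d' (k' : d'.-tuple int) (c' : R) y : (0 <= (1 + cos (dotp k' y + c'))%:E)%E.
  by rewrite lee_fin -lerBlDl add0r cos_geN1.
elim: d k c => [|d IH] k c.
  rewrite /= integral_dirac//; last exact: mf.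
  rewrite diracE mem_set// mul1e /dotp big_ord0 add0r.
  by rewrite (tuple0 k) (tuple0 (nseq_tuple 0 _)) eqxx mul1r.
rewrite /= ge0_integral_distribution//; last exact: mf.
rewrite fubini_tonelli2; last 2 first.
- by apply: measurableT_comp; [exact: mf|exact: measurable_tcons].
- by move=> p; exact: f0.
pose k0 := thead k; pose k' := [tuple of behead k].
have E (p : measurableTypeR R * Rd R d) : dotp k (tcons p) + c = k0%:~R * p.1 + (dotp k' p.2 + c).
  rewrite addrA /dotp big_ord_recl; congr (_ + _ + _).
  apply: eq_bigr => j _; congr (_%:~R * _).
    by rewrite tnth_behead; congr (tnth _ _); apply: val_inj; rewrite /= inordK// ltnS.
  by rewrite /tcons (tnth_nth 0) /= (tnth_nth 0).
rewrite /fubini_G /=.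
under eq_integral => y _.
  under eq_integral => x _ do rewrite E /=.
  rewrite integral_cos_cell.
  over.
have -> : (k == nseq_tuple d.+1 0) = (k0 == 0) && (k' == nseq_tuple d 0).
  by rewrite [k in LHS]tuple_eta -/k0 -val_eqE /= eqseq_cons -val_eqE.
(* A nonzero first frequency leaves the constant 1 after the inner integral; a zero one leaves the
   same integral in one dimension less. *)
have [_|_] := eqVneq k0 0; last first.
  under eq_integral do rewrite mul0r addr0.
  rewrite mul0r addr0 integral_cst// mul1e.
  exact: probability_setT.
by under eq_integral do rewrite mul1r; rewrite IH.
Qed.
End trigonometric_integrals.

(** * Integration of bounded measurable functions *)

Section bounded_measurable.
Context {R : realType} (d : nat).
Local Notation mu := (@torus_measure R d).
Implicit Types f g : Rd R d -> R.

(** A class closed under sums and products whose members are integrable for the probability [mu], so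
    that linearity and monotonicity of the integral apply at once. *)
Definition bmeas f := measurable_fun [set: Rd R d] f /\ exists M : R, forall x, `|f x| <= M.

Lemma bmeas_integrable f : bmeas f -> mu.-integrable [set: Rd R d] (EFin \o f).
Proof.
move=> [mf [M fM]]; apply: measurable_bounded_integrable => //.
  by apply: (le_lt_trans (probability_le1 _ _)); rewrite ?ltry.
exists M; split; first exact: num_real.
by move=> x Mx y _ /=; exact: le_trans (fM y) (ltW Mx).
Qed.

Lemma bmeas_cst (c : R) : bmeas (fun=> c).
Proof. by split; [exact: measurable_cst|exists `|c|]. Qed.

Lemma bmeasD f g : bmeas f -> bmeas g -> bmeas (fun x => f x + g x).
Proof.
move=> [mf [M fM]] [mg [M' gM]]; split; first exact: measurable_funD.
by exists (M + M') => x; apply: (le_trans (ler_normD _ _)); exact: lerD.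
Qed.

Lemma bmeasM f g : bmeas f -> bmeas g -> bmeas (fun x => f x * g x).
Proof.
move=> [mf [M fM]] [mg [M' gM]]; split; first exact: measurable_funM.
by exists (M * M') => x; rewrite normrM; apply: ler_pM.
Qed.

Lemma bmeasX f n : bmeas f -> bmeas (fun x => f x ^+ n).
Proof.
move=> bf; elim: n => [|n IH]; first exact: bmeas_cst.
by under eq_fun do rewrite exprS; exact: bmeasM.
Qed.

Lemma bmeas_sum (I : Type) (s : seq I) (F : I -> Rd R d -> R) :
  (forall i, bmeas (F i)) -> bmeas (fun x => \sum_(i <- s) F i x).
Proof.
move=> bF; elim: s => [|i s IH].
  by under eq_fun do rewrite big_nil; exact: bmeas_cst.
by under eq_fun do rewrite big_cons; exact: bmeasD.
Qed.

Lemma bmeas_cos (k : d.-tuple int) (c : R) : bmeas (fun x => cos (dotp k x + c)).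
Proof.
split; last by exists 1 => x; rewrite ler_norml cos_geN1 cos_le1.
apply: measurableT_comp; first exact: measurable_cos.
by apply: measurable_funD; [exact: measurable_dotp|exact: measurable_cst].
Qed.

Lemma bmeas_sqrt f : bmeas f -> bmeas (fun x => Num.sqrt (f x)).
Proof.
move=> [mf [M fM]]; split.
  apply: measurableT_comp mf.
  by apply: continuous_measurable_fun => x; exact: sqrt_continuous.
exists (Num.sqrt M) => x; rewrite ger0_norm ?sqrtr_ge0// ler_wsqrtr//.
exact: le_trans (ler_norm _) (fM x).
Qed.

Lemma bmeas_RintegralD f g : bmeas f -> bmeas g ->
  \int[mu]_x (f x + g x) = \int[mu]_x f x + \int[mu]_x g x.
Proof. by move=> /bmeas_integrable bf /bmeas_integrable bg; exact: RintegralD. Qed.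

Lemma bmeas_RintegralZ (c : R) f : bmeas f -> \int[mu]_x (c * f x) = c * \int[mu]_x f x.
Proof. by move=> /bmeas_integrable bf; exact: RintegralZl. Qed.

Lemma Rintegral_torus_cst (c : R) : \int[mu]_x c = c.
Proof.
rewrite Rintegral_cst// [X in fine X](_ : _ = 1%E) ?mulr1//; exact: probability_setT.
Qed.

Lemma bmeas_Rintegral_sum (I : Type) (s : seq I) (F : I -> Rd R d -> R) :
  (forall i, bmeas (F i)) ->
  \int[mu]_x (\sum_(i <- s) F i x) = \sum_(i <- s) \int[mu]_x F i x.
Proof.
move=> bF; elim: s => [|i s IH].
  by under eq_Rintegral do rewrite big_nil; rewrite Rintegral_torus_cst big_nil.
under eq_Rintegral do rewrite big_cons.
by rewrite bmeas_RintegralD ?IH ?big_cons//; exact: bmeas_sum.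
Qed.

Lemma bmeas_le_Rintegral f g : bmeas f -> bmeas g -> (forall x, f x <= g x) ->
  \int[mu]_x f x <= \int[mu]_x g x.
Proof.
move=> /bmeas_integrable bf /bmeas_integrable bg fg; exact: le_Rintegral.
Qed.

Lemma Rintegral_cos (k : d.-tuple int) (c : R) :
  \int[mu]_x cos (dotp k x + c) = (k == nseq_tuple d 0)%:R * cos c.
Proof.
have h : \int[mu]_x (1 + cos (dotp k x + c)) = 1 + (k == nseq_tuple d 0)%:R * cos c.
  by rewrite /Rintegral integral_cos_tonelli.
move: h; rewrite bmeas_RintegralD; [|exact: bmeas_cst|exact: bmeas_cos].
by rewrite Rintegral_torus_cst => /addrI.
Qed.

Lemma cnorm1E (f : Rd R d -> R[i]) : bmeas (fun x => Normc.normc (f x)) ->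
  cnorm 1 f = (\int[mu]_x Normc.normc (f x))%:E.
Proof.
move=> bf; rewrite /cnorm Lnorm1 /Rintegral.
under eq_integral => x _.
  rewrite /= ger0_norm; last by case: (f x) => u v; rewrite /= sqrtr_ge0.
  over.
by rewrite fineK//; apply: integrable_fin_num => //; exact: bmeas_integrable.
Qed.

Lemma normcE (z : R[i]) :
  Normc.normc z = Num.sqrt (complex.Re z ^+ 2 + complex.Im z ^+ 2).
Proof. by case: z. Qed.

Lemma normc_le_ReIm (z : R[i]) : Normc.normc z <= `|complex.Re z| + `|complex.Im z|.
Proof.
rewrite normcE -[leRHS](@ger0_norm) ?addr_ge0// -sqrtr_sqr ler_wsqrtr//.
by rewrite sqrrD !real_normK ?num_real// -addrA lerD2l lerDr mulrn_wge0// mulr_ge0.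
Qed.

Lemma measurable_normc (f : Rd R d -> R[i]) : cmeasurable f ->
  measurable_fun [set: Rd R d] (fun x => Normc.normc (f x)).
Proof.
move=> [mr mi]; under eq_fun do rewrite normcE.
apply: measurableT_comp.
  by apply: continuous_measurable_fun => x; exact: sqrt_continuous.
by apply: measurable_funD; exact: measurable_funX.
Qed.

Lemma cnorm1_triangle (f g y : Rd R d -> R[i]) :
  cmeasurable f -> cmeasurable g -> cmeasurable y ->
  (cnorm 1 (f - g)%R <= cnorm 1 (f - y)%R + cnorm 1 (g - y)%R)%E.
Proof.
have cB (u v : Rd R d -> R[i]) : cmeasurable u -> cmeasurable v -> cmeasurable (u - v)%R.
  move=> [ur ui] [vr vi]; split.
    rewrite (_ : (fun x => _) = (fun x => complex.Re (u x) - complex.Re (v x))).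
      exact: measurable_funB.
    by apply/funext => x; rewrite !fctE; case: (u x) => ? ?; case: (v x).
  rewrite (_ : (fun x => _) = (fun x => complex.Im (u x) - complex.Im (v x))).
    exact: measurable_funB.
  by apply/funext => x; rewrite !fctE; case: (u x) => ? ?; case: (v x).
move=> mf mg my.
have mN (u v : Rd R d -> R[i]) : cmeasurable u -> cmeasurable v ->
    measurable_fun [set: Rd R d] (fun x => `|(Normc.normc ((u - v)%R x))%:E|%E).
  move=> mu' mv; apply: measurableT_comp => //; apply/measurable_EFinP.
  by apply: measurable_normc; exact: cB.
rewrite /cnorm !Lnorm1 -ge0_integralD//; [|exact: mN..].
apply: ge0_le_integral => //.
- exact: mN.
- by apply: emeasurable_funD; exact: mN.
move=> x _; rewrite /= -EFinD lee_fin !ger0_norm ?normcE ?sqrtr_ge0//.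
rewrite -!normcE !fctE; apply: le_trans (_ : Normc.normc ((f x - y x) + (y x - g x)) <= _).
  by rewrite addrA subrK.
by apply: (le_trans (le_normcD _ _)); rewrite lerD2l -[y x - g x]opprB normcN.
Qed.
End bounded_measurable.

(** * Trigonometric polynomials *)

Section trigonometric_polynomials.
Context {R : realType} (d : nat) (I : finType) (kap : I -> d.-tuple int).
Local Notation mu := (@torus_measure R d).
Implicit Types c : I -> R.

(** With real coefficients, the polynomial sum c_i e^(i(kap i, x)) splits into a cosine and a sine
    sum with the same coefficients, so that real integrals suffice. *)
Definition tre c (x : Rd R d) : R := \sum_i c i * cos (dotp (kap i) x).
Definition tim c (x : Rd R d) : R := \sum_i c i * sin (dotp (kap i) x).
Definition tpoly c (x : Rd R d) : R[i] := Complex (tre c x) (tim c x).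

Definition tsub (k l : d.-tuple int) : d.-tuple int :=
  [tuple tnth k j - tnth l j | j < d].

Lemma dotp_sub k l (x : Rd R d) : dotp (tsub k l) x = dotp k x - dotp l x.
Proof.
rewrite /dotp -sumrB; apply: eq_bigr => j _.
by rewrite tnth_mktuple rmorphB /= mulrBl.
Qed.

Lemma tsub_eq0 k l : (tsub k l == nseq_tuple d 0) = (k == l).
Proof.
apply/eqP/eqP => [e|->]; apply: eq_from_tnth => j.
  have := congr1 (fun t : d.-tuple int => tnth t j) e; rewrite tnth_mktuple tnth_nseq.
  by move/eqP; rewrite subr_eq0 => /eqP.
by rewrite tnth_mktuple tnth_nseq subrr.
Qed.

Lemma bmeas_cosd k : bmeas (fun x : Rd R d => cos (dotp k x)).
Proof. by under eq_fun do rewrite -[dotp _ _]addr0; exact: bmeas_cos. Qed.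

Lemma bmeas_sind k : bmeas (fun x : Rd R d => sin (dotp k x)).
Proof. by under eq_fun do rewrite sin_cos; exact: bmeas_cos. Qed.

Lemma bmeas_tre c : bmeas (tre c).
Proof. by apply: bmeas_sum => i; apply: bmeasM; [exact: bmeas_cst|exact: bmeas_cosd]. Qed.

Lemma bmeas_tim c : bmeas (tim c).
Proof. by apply: bmeas_sum => i; apply: bmeasM; [exact: bmeas_cst|exact: bmeas_sind]. Qed.

Lemma bmeas_normc_tpoly c : bmeas (fun x => Normc.normc (tpoly c x)).
Proof.
apply: bmeas_sqrt; apply: bmeasD; apply: bmeasX; [exact: bmeas_tre|exact: bmeas_tim].
Qed.

Lemma Rintegral_cosd k : \int[mu]_x cos (dotp k x) = (k == nseq_tuple d 0)%:R.
Proof. by under eq_Rintegral do rewrite -[dotp _ _]addr0; rewrite Rintegral_cos cos0 mulr1. Qed.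

Lemma Rintegral_sind k : \int[mu]_x sin (dotp k x) = 0.
Proof.
under eq_Rintegral do rewrite sin_cos.
by rewrite Rintegral_cos cosN cos_pihalf mulr0.
Qed.

(** |f|^2 expands into a double sum of cosines of frequency differences; only the diagonal has
    nonzero mean, the frequencies being distinct. *)
Lemma parseval c : injective kap ->
  \int[mu]_x (tre c x ^+ 2 + tim c x ^+ 2) = \sum_i c i ^+ 2.
Proof.
move=> inj.
have E x : tre c x ^+ 2 + tim c x ^+ 2 =
    \sum_i \sum_j c i * c j * cos (dotp (tsub (kap i) (kap j)) x).
  rewrite !expr2 {1}/tre {1}/tim !mulr_suml -big_split; apply: eq_bigr => i _ /=.
  rewrite /tre /tim !mulr_sumr -big_split; apply: eq_bigr => j _ /=.
  by rewrite dotp_sub cosB; ring.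
under eq_Rintegral do rewrite E.
have b i j : bmeas (fun x : Rd R d => c i * c j * cos (dotp (tsub (kap i) (kap j)) x)).
  by apply: bmeasM; [exact: bmeas_cst|exact: bmeas_cosd].
rewrite bmeas_Rintegral_sum; last by move=> i; apply: bmeas_sum => j; exact: b.
apply: eq_bigr => i _; rewrite bmeas_Rintegral_sum// (bigD1 i)//= big1 ?addr0.
  by rewrite bmeas_RintegralZ ?Rintegral_cosd ?tsub_eq0 ?eqxx ?mulr1 ?expr2//; exact: bmeas_cosd.
move=> j ji; rewrite bmeas_RintegralZ; last exact: bmeas_cosd.
by rewrite Rintegral_cosd tsub_eq0 (inj_eq inj) eq_sym (negbTE ji) mulr0.
Qed.

Lemma fourier_coef_tpoly c k :
  fourier_coef (tpoly c) k = Complex (\sum_(i | kap i == k) c i) 0.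
Proof.
have bZ (f : Rd R d -> R) (a : R) : bmeas f -> bmeas (fun x => a * f x).
  by move=> bf; apply: bmeasM => //; exact: bmeas_cst.
rewrite /fourier_coef /cintegral; congr Complex.
  transitivity (\int[mu]_x \sum_i c i * cos (dotp (tsub (kap i) k) x)).
    apply: eq_Rintegral => x _ /=; rewrite cosN sinN mulrN opprK.
    rewrite /tre /tim !mulr_suml -big_split; apply: eq_bigr => i _ /=.
    by rewrite dotp_sub cosB; ring.
  rewrite bmeas_Rintegral_sum; last by move=> i; apply: bZ; exact: bmeas_cosd.
  rewrite [RHS]big_mkcond; apply: eq_bigr => i _.
  rewrite bmeas_RintegralZ; last exact: bmeas_cosd.
  by rewrite Rintegral_cosd tsub_eq0; case: eqP; rewrite ?mulr1 ?mulr0.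
transitivity (\int[mu]_x \sum_i c i * sin (dotp (tsub (kap i) k) x)).
  apply: eq_Rintegral => x _ /=; rewrite cosN sinN mulrN.
  rewrite /tre /tim !mulr_suml -sumrN -big_split; apply: eq_bigr => i _ /=.
  by rewrite dotp_sub sinB; ring.
rewrite bmeas_Rintegral_sum; last by move=> i; apply: bZ; exact: bmeas_sind.
rewrite big1// => i _.
by rewrite bmeas_RintegralZ ?Rintegral_sind ?mulr0//; exact: bmeas_sind.
Qed.

Lemma expi_shift (t : R) (n : int) : expi (t + 2 * pi * n%:~R) = expi t.
Proof. by rewrite /expi cos_period !sin_cos addrAC cos_period. Qed.

Lemma tpoly_sum c x : tpoly c x = \sum_i Complex (c i) 0 * expi (dotp (kap i) x).
Proof.
rewrite /tpoly /tre /tim; apply: (big_ind3 (fun a b z => Complex a b = z)) => //= [|i _].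
  by move=> a1 b1 c1 a2 b2 c2 <- <-.
rewrite [RHS](_ : _ = Complex (c i * cos (dotp (kap i) x) - 0 * sin (dotp (kap i) x))
  (c i * sin (dotp (kap i) x) + 0 * cos (dotp (kap i) x)))//.
by rewrite !mul0r subr0 addr0.
Qed.

Lemma tpoly_periodic c : torus_periodic (tpoly c).
Proof.
move=> x j; rewrite !tpoly_sum; apply: eq_bigr => i _; congr (_ * _).
rewrite -[RHS](expi_shift _ (tnth (kap i) j)); congr expi.
rewrite /dotp (bigD1 j)//= [in RHS](bigD1 j)//= tnth_mktuple eqxx.
rewrite mulrDr [RHS]addrAC [_ * (2 * pi)]mulrC; congr (_ + _).
by apply: eq_bigr => l lj; rewrite tnth_mktuple (negbTE lj) addr0.
Qed.

Lemma cmeasurable_tpoly c : cmeasurable (tpoly c).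
Proof. by split; [case: (bmeas_tre c)|case: (bmeas_tim c)]. Qed.

Lemma tpoly_L1 c : Lp 1 (tpoly c).
Proof.
split; [exact: tpoly_periodic|exact: cmeasurable_tpoly|].
by rewrite cnorm1E ?ltry//; exact: bmeas_normc_tpoly.
Qed.

(** * Dyadic blocks and layers *)

(** Each entry is the number of binary digits of |k_j|, which is 0 for k_j = 0; this is the index of
    the only dyadic block containing k. *)
Definition blk (k : d.-tuple int) : d.-tuple nat :=
  [tuple up_log 2 `|tnth k j|%N.+1 | j < d].

Lemma up_log_blockE (a s' : nat) :
  (2 ^ s' %/ 2 <= a < 2 ^ s')%N <-> s' = up_log 2 a.+1.
Proof.
split => [/andP[h1 h2]|->].
  apply/eqP; rewrite eqn_leq; apply/andP; split; last first.
    exact: up_log_min.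
  rewrite leqNgt; apply/negP => lt.
  case: s' h1 h2 lt => // s' h1 h2 lt.
  have : (a.+1 <= 2 ^ s')%N.
    by apply: (leq_trans (@up_logP 2 a.+1 isT)); rewrite leq_exp2l.
  by move: h1; rewrite expnS mulKn// => h1; rewrite ltnNge h1.
rewrite up_logP// andbT.
case E : (up_log 2 a.+1) => [|e]; first by rewrite expn0.
rewrite expnS mulKn// leqNgt; apply/negP => h.
have := up_log_min (isT : 1 < 2)%N h; by rewrite E ltnn.
Qed.

Lemma rhoE s k : rho s k <-> s = blk k.
Proof.
split => [h|->].
  by apply: eq_from_tnth => j; rewrite tnth_mktuple; apply/up_log_blockE/h.
by move=> j; apply/up_log_blockE; rewrite tnth_mktuple.
Qed.

(** The sum over the block is narrowed to the frequencies of the polynomial that lie in it, the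
    other Fourier coefficients being zero. *)
Lemma delta_tpoly c s x : injective kap ->
  delta s (tpoly c) x =
  \sum_(i | blk (kap i) == s) Complex (c i) 0 * expi (dotp (kap i) x).
Proof.
move=> inj; pose r := [seq kap i | i <- enum I & blk (kap i) == s].
have ur : uniq r by rewrite map_inj_uniq// filter_uniq// enum_uniq.
rewrite /delta -(@fsbig_widen _ _ _ _ [set` r]%classic); last 2 first.
- move=> k /= kr; case: (elimT mapP kr) => i.
  by rewrite mem_filter => /andP[/eqP <- _] ->; apply/rhoE.
- move=> k /= [/rhoE sk kr]; rewrite fourier_coef_tpoly big1 ?mul0r// => i /eqP ik.
  by case: kr; apply/mapP; exists i => //; rewrite mem_filter mem_enum ik sk eqxx.
rewrite -fsbig_seq// big_map big_filter big_enum_cond/=; apply: eq_bigr => i _.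
rewrite fourier_coef_tpoly (bigD1 i)//= big1 ?addr0// => j /andP[/eqP /inj ->].
by rewrite eqxx.
Qed.

(** Membership in the class thus reduces to a bound on one layer. Grouping frequencies by blocks
    recovers the polynomial for l = n; for other l no block of the layer meets the spectrum. *)
Lemma layer_tpoly c n l : injective kap ->
  (forall i, \sum_(j < d) tnth (blk (kap i)) j = n)%N ->
  layer l (tpoly c) = if l == n then tpoly c else 0.
Proof.
move=> inj hn; apply/funext => x; rewrite /layer.
under eq_fsbigr do rewrite delta_tpoly//.
case: eqVneq => [->|ln]; last first.
  rewrite fsbig1// => s /= sl; rewrite big1// => i /eqP is_.
  by move: ln; rewrite -sl -(hn i) is_ eqxx.
pose r := undup [seq blk (kap i) | i <- enum I].
rewrite -(@fsbig_widen _ _ _ _ [set` r]%classic); last 2 first.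
- move=> s /=; rewrite mem_undup => sr.
  by case: (elimT mapP sr) => i _ ->; exact: hn.
- move=> s /= [_ sr]; rewrite big1// => i /eqP is_.
  by case: sr; rewrite mem_undup; apply: (introT mapP); exists i => //; rewrite mem_enum.
rewrite -fsbig_seq ?undup_uniq// tpoly_sum.
under eq_bigr do rewrite big_mkcond.
rewrite exchange_big /=; apply: eq_bigr => i _.
rewrite (bigD1_seq (blk (kap i))) ?undup_uniq//=; last first.
  by rewrite mem_undup; apply: (introT mapP); exists i => //; rewrite mem_enum.
rewrite eqxx big1 ?addr0// => s; by rewrite eq_sym => /negbTE ->.
Qed.

(* u >= u^2 - u^4 for u >= 0, applied to u = |f| / A *)
Lemma L1_lower c (A : R) : injective kap -> 0 < A ->
  (\sum_i c i ^+ 2) / A <= \int[mu]_x Normc.normc (tpoly c x) +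
    2 / A ^+ 3 * \int[mu]_x (tre c x ^+ 4 + tim c x ^+ 4).
Proof.
move=> inj A0; rewrite -parseval// mulrC.
have b2 : bmeas (fun x => tre c x ^+ 2 + tim c x ^+ 2).
  by apply: bmeasD; apply: bmeasX; [exact: bmeas_tre|exact: bmeas_tim].
have b4 : bmeas (fun x => tre c x ^+ 4 + tim c x ^+ 4).
  by apply: bmeasD; apply: bmeasX; [exact: bmeas_tre|exact: bmeas_tim].
have bn := bmeas_normc_tpoly c.
rewrite -!bmeas_RintegralZ// -bmeas_RintegralD//; last first.
  by apply: bmeasM => //; exact: bmeas_cst.
apply: bmeas_le_Rintegral.
- by apply: bmeasM => //; exact: bmeas_cst.
- by apply: bmeasD => //; apply: bmeasM => //; exact: bmeas_cst.
move=> x; rewrite normcE /=; set a := tre c x; set b := tim c x.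
set q := a ^+ 2 + b ^+ 2; have q0 : 0 <= q by rewrite addr_ge0 ?sqr_ge0.
set u := Num.sqrt q; have u0 : 0 <= u by rewrite sqrtr_ge0.
have uq : u ^+ 2 = q by rewrite sqr_sqrtr.
have h1 : q ^+ 2 <= 2 * (a ^+ 4 + b ^+ 4).
  rewrite -subr_ge0 (_ : _ - _ = (a ^+ 2 - b ^+ 2) ^+ 2) ?sqr_ge0//.
  by rewrite /q; ring.
have key (v : R) : 0 <= v -> v ^+ 2 <= v + v ^+ 4.
  move=> v0; have [v1|v1] := leP v 1.
    have := exprn_ge0 4 v0; have : v ^+ 2 <= v by rewrite expr2 ler_piMl.
    lra.
  have : v ^+ 2 <= v ^+ 4 by rewrite ler_eXn2l ?ltW.
  lra.
have := key (u / A) (divr_ge0 u0 (ltW A0)).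
have h3 : A ^-1 * q <= u + (A ^+ 3)^-1 * q ^+ 2 -> 
   A^-1 * q <= u + 2 / A ^+ 3 * (a ^+ 4 + b ^+ 4).
  move=> /le_trans; apply; rewrite lerD2l mulrAC -[leRHS]mulrC ler_wpM2l//.
  by rewrite invr_ge0 exprn_ge0 ?ltW.
move=> h; apply: h3; move: h.
rewrite -(ler_pM2l A0); congr (_ <= _).
  by rewrite -uq; field; rewrite gt_eqF.
by rewrite -uq; field; rewrite gt_eqF.
Qed.

End trigonometric_polynomials.

(** * Random signs *)

Section good_signs.
Context {R : realType} (d n : nat) (I : finType) (kap : I -> d.-tuple int).
Local Notation mu := (@torus_measure R d).
Local Notation N := #|I|.
Context (d0 : (0 < d)%N) (n0 : (0 < n)%N) (N0 : (0 < N)%N).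
Context (N_le : (N <= 2 ^ (n * d))%N).
Context (freq : forall i j, (`|tnth (kap i) j| < 2 ^ n)%N).
Implicit Types s : {ffun I -> bool}.

Definition spoly s : Rd R d -> R[i] := tpoly kap (fun i => sgb (s i)).
(** A substitute for |f_s|_4^4, comparable to it up to a factor 2, to which the bound for real
    Rademacher sums applies part by part. *)
Definition fourth s : R :=
  \int[mu]_x (tre kap (fun i => sgb (s i)) x ^+ 4 + tim kap (fun i => sgb (s i)) x ^+ 4).

Lemma rad_union (G : finType) (a : G -> I -> R) (t : R) :
  (forall g i, `|a g i| <= 1) -> 0 <= t ->
  #|[set s | [exists g, t <= radsum (a g) s]]|%:R <=
    #|G|%:R * (2 ^+ N * expR (- (t ^+ 2 / (8 * N%:R)))) :> R.
Proof.
move=> a1 t0.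
have h : (#|[set s | [exists g, (t <= radsum (a g) s)%R]]| <=
    \sum_g #|[set s | (t <= radsum (a g) s)%R]|)%N.
  rewrite [X in (_ <= X)%N](eq_bigr (fun g => \sum_(s | (t <= radsum (a g) s)%R) 1%N)); last first.
    by move=> g _; rewrite sum1dep_card.
  rewrite (exchange_big_dep xpredT)//= -sum1dep_card big_mkcond leq_sum// => s _.
  by case: ifP => // /existsP[g hg]; rewrite (bigD1 g).
move: h; rewrite -(ler_nat R) natr_sum => /le_trans; apply.
rewrite mulr_natl -sumr_const; apply: ler_sum => g _; exact: rad_tail.
Qed.

(** Grid points per coordinate. The phase error is at most d 2^n 2 pi / M, and this M makes N times
    that bound equal to pi / 4 < 1. *)
Let M : nat := (N * d * 2 ^ n * 8)%N.

Definition gridpt (g : {ffun 'I_d -> 'I_M}) : Rd R d :=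
  [tuple 2 * pi * (g j)%:R / M%:R | j < d].

Lemma M_gt0 : (0 < M)%N.
Proof. by rewrite !muln_gt0 N0 d0 expn_gt0. Qed.

Lemma nat_le_expR (m : nat) : m%:R <= expR m%:R :> R.
Proof. by apply: le_trans (expR_ge1Dx _); rewrite lerDr. Qed.

Lemma exp2_le_expR (m : nat) : 2 ^+ m <= expR m%:R :> R.
Proof.
rewrite -[m%:R]mulr1 expRM_natl lerXn2r ?nnegrE ?expR_ge0//.
exact: (expR_ge1Dx (1 : R)).
Qed.

(** From N <= 2^(n d) one gets M <= exp (6 d n). The factor 16 prepares 4 test vectors per grid
    point and a proportion 1/4 of bad signs. *)
Lemma grid_card : (16 * M%:R ^+ d <= expR (10 * d%:R ^+ 2 * n%:R) :> R).
Proof.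
have d1 : 1 <= d%:R :> R by rewrite ler1n.
have n1 : 1 <= n%:R :> R by rewrite ler1n.
have hM : M%:R <= expR (6 * d%:R * n%:R) :> R.
  rewrite /M !natrM natrX.
  apply: (@le_trans _ _ (expR (n * d)%:R * expR d%:R * expR n%:R * expR 3%:R)).
    apply: ler_pM; rewrite ?mulr_ge0 ?exprn_ge0//; last first.
      by rewrite (_ : 8%:R = 2 ^+ 3 :> R) ?exp2_le_expR// -natrX.
    apply: ler_pM; rewrite ?mulr_ge0 ?exprn_ge0//; last exact: exp2_le_expR.
    apply: ler_pM; rewrite ?nat_le_expR//.
    by apply: le_trans (exp2_le_expR _); rewrite -natrX ler_nat.
  rewrite -!expRD ler_expR natrM.
  have := mulr_ge0 (ler0n R n) (ler0n R d).
  have : 0 <= (d%:R - 1) * (n%:R - 1) :> R by rewrite mulr_ge0// subr_ge0.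
  nra.
have -> : 10 * d%:R ^+ 2 * n%:R = (4 * d%:R ^+ 2 * n%:R) + d%:R * (6 * d%:R * n%:R) :> R by ring.
rewrite expRD expRM_natl; apply: ler_pM => //.
  rewrite (_ : 16 = 2 ^+ 4 :> R); last by rewrite -natrX.
  apply: (le_trans (exp2_le_expR _)); rewrite ler_expR -mulrA ler_peMr//.
  by apply: mulr_ege1 => //; rewrite exprn_ege1.
by rewrite lerXn2r ?nnegrE ?expR_ge0.
Qed.

(** The point x ranges over all of R^d: it is rounded down to a lattice point, whose indices are
    then reduced modulo M. The number y is the phase at the unreduced lattice point, close to that
    of x and congruent modulo 2 pi to that of the grid point. *)
Lemma grid_approx (x : Rd R d) : exists g : {ffun 'I_d -> 'I_M}, forall i,
  exists2 y : R, expi y = expi (dotp (kap i) (gridpt g)) &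
    N%:R * `|dotp (kap i) x - y| <= 1.
Proof.
have M0 : 0 < M%:R :> R by rewrite ltr0n M_gt0.
have Mn : (M%:R : R) != 0 by rewrite gt_eqF.
have p0 := @twopi_gt0 R.
pose z (j : 'I_d) : int := Num.floor (tnth x j * M%:R / (2 * pi)).
have zM j : (0 <= z j %% M < M)%Z.
  by rewrite modz_ge0 ?ltz_pmod ?ltz_nat ?M_gt0// eqz_nat -lt0n M_gt0.
have zl j : (`|(z j %% M)%Z| < M)%N.
  by have /andP[h1 h2] := zM j; rewrite -ltz_nat gez0_abs.
pose g : {ffun 'I_d -> 'I_M} := [ffun j => Ordinal (zl j)].
exists g => i.
pose y : Rd R d := [tuple 2 * pi * (z j)%:~R / M%:R | j < d].
have gE j : tnth y j = tnth (gridpt g) j + 2 * pi * (z j %/ M)%Z%:~R.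
  rewrite !tnth_mktuple ffunE /=.
  have -> : (`|(z j %% M)%Z|%N)%:R = (z j %% M)%Z%:~R :> R.
    by rewrite -[in RHS](@gez0_abs (z j %% M)%Z)//; case/andP: (zM j).
  rewrite {1}(divz_eq (z j) M) rmorphD rmorphM /=.
  set u := ((z j %/ M)%Z)%:~R; set v := ((z j %% M)%Z)%:~R.
  rewrite (_ : (M%:~R : R) = M%:R)//; by field.
exists (dotp (kap i) y).
  rewrite -[RHS](expi_shift _ (\sum_j tnth (kap i) j * (z j %/ M)%Z)); congr expi.
  rewrite /dotp rmorph_sum /= mulr_sumr -big_split; apply: eq_bigr => j _ /=.
  by rewrite gE rmorphM /=; ring.
have dist j : `|tnth x j - tnth y j| <= 2 * pi / M%:R.
  rewrite tnth_mktuple.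
  have /andP[h1 h2] := floor_itv (tnth x j * M%:R / (2 * pi)); rewrite -/(z j) in h1 h2.
  have c0 : 0 < 2 * pi / M%:R :> R by rewrite divr_gt0.
  have -> : tnth x j - 2 * pi * (z j)%:~R / M%:R =
     (2 * pi / M%:R) * (tnth x j * M%:R / (2 * pi) - (z j)%:~R).
    set w := (z j)%:~R; move: (@pi R) (gt_eqF (@pi_gt0 R)) => P P0; field.
    by rewrite P0 pnatr_eq0 -lt0n M_gt0.
  rewrite normrM (gtr0_norm c0) -[leRHS]mulr1 ler_wpM2l ?(ltW c0)//.
  rewrite ger0_norm ?subr_ge0// lerBlDl; apply: ltW.
  by move: h2; rewrite rmorphD.
have -> : dotp (kap i) x - dotp (kap i) y = \sum_j (tnth (kap i) j)%:~R * (tnth x j - tnth y j).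
  by rewrite /dotp -sumrB; apply: eq_bigr => j _; rewrite mulrBr.
have h : `|\sum_j (tnth (kap i) j)%:~R * (tnth x j - tnth y j)| <=
    d%:R * (2 ^+ n * (2 * pi / M%:R)).
  apply: (le_trans (ler_norm_sum _ _ _)).
  rewrite (_ : d%:R * _ = \sum_(j < d) 2 ^+ n * (2 * pi / M%:R)); last first.
    by rewrite sumr_const card_ord mulr_natl.
  apply: ler_sum => j _.
  rewrite normrM; apply: ler_pM => //.
  by rewrite -intr_norm -natrX -abszE; rewrite [leLHS](_ : _ = `|tnth (kap i) j|%N%:R)// ler_nat ltnW.
apply: (le_trans (ler_wpM2l (ler0n R N) h)).
have -> : N%:R * (d%:R * (2 ^+ n * (2 * pi / M%:R))) = pi / 4 :> R.
  rewrite /M !natrM natrX; field.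
  by rewrite !pnatr_eq0 -!lt0n N0 d0 /= expf_neq0// pnatr_eq0.
have := @pihalf_lt2 R; lra.
Qed.

Lemma sin_lip (u v : R) : `|sin u - sin v| <= `|u - v|.
Proof.
by rewrite !sin_cos; apply: (le_trans (cos_lip _ _)); rewrite opprB addrA subrK.
Qed.

Lemma spoly_grid s (x : Rd R d) : exists g : {ffun 'I_d -> 'I_M},
  `|tre kap (fun i => sgb (s i)) x - tre kap (fun i => sgb (s i)) (gridpt g)| <= 1 /\
  `|tim kap (fun i => sgb (s i)) x - tim kap (fun i => sgb (s i)) (gridpt g)| <= 1.
Proof.
have [g hg] := grid_approx x; exists g.
have NR : 0 < N%:R :> R by rewrite ltr0n.
have sumN : \sum_(i : I) N%:R^-1 = 1 :> R.
  by rewrite sumr_const -[_ *+ _]mulr_natr mulVf// gt_eqF.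
split; rewrite -sumrB; apply: (le_trans (ler_norm_sum _ _ _)); rewrite -sumN;
  apply: ler_sum => i _; rewrite -mulrBr normrM normr_sgb mul1r;
  have [y hy hN] := hg i; move: hN; rewrite mulrC -ler_pdivlMr// div1r => hN;
  apply: le_trans hN.
- have hc : cos y = cos (dotp (kap i) (gridpt g)) := congr1 (@complex.Re R) hy.
  by rewrite -hc; exact: cos_lip.
- have hc : sin y = sin (dotp (kap i) (gridpt g)) := congr1 (@complex.Im R) hy.
  by rewrite -hc; exact: sin_lip.
Qed.

Lemma sup_signs : exists B : {set {ffun I -> bool}},
  4 * #|B|%:R <= 2 ^+ N :> R /\
  forall s, s \notin B -> forall x,
    Normc.normc (spoly s x) <= 36 * d%:R * Num.sqrt (N%:R * n%:R).
Proof.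
have NR : 1 <= N%:R :> R by rewrite ler1n.
have dR : 1 <= d%:R :> R by rewrite ler1n.
have nR : 1 <= n%:R :> R by rewrite ler1n.
set r := Num.sqrt (N%:R * n%:R).
have r1 : 1 <= r by rewrite -sqrtr1 ler_wsqrtr// mulr_ege1.
have rr : r ^+ 2 = N%:R * n%:R by rewrite sqr_sqrtr// mulr_ge0.
(* The factor 9 gives t^2 / (8 N) = 81 d^2 n / 8 >= 10 d^2 n, enough to absorb the 16 M^d of
   [grid_card]. *)
pose t := 9 * d%:R * r.
have t1 : 1 <= t by rewrite !mulr_ege1// ler1n.
(* The two Booleans choose the sign and the real or imaginary part, so that one-sided tails control
   both absolute values. *)
pose a (g : {ffun 'I_d -> 'I_M} * (bool * bool)) (i : I) : R :=
  sgb g.2.1 * (if g.2.2 then cos else sin) (dotp (kap i) (gridpt g.1)).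
exists [set s | [exists g, t <= radsum (a g) s]]; split.
  apply: (@le_trans _ _ (4 * (#|{: {ffun 'I_d -> 'I_M} * (bool * bool)}|%:R *
      (2 ^+ N * expR (- (t ^+ 2 / (8 * N%:R))))))).
    rewrite ler_wpM2l//; apply: rad_union; last exact: le_trans t1.
    move=> [g [b1 b2]] i; rewrite /a normrM normr_sgb mul1r /=.
    by case: b2; rewrite ler_norml ?cos_geN1 ?cos_le1 ?sin_geN1 ?sin_le1.
  rewrite !card_prod !card_bool card_ffun !card_ord !natrM natrX.
  have h1 : expR (- (t ^+ 2 / (8 * N%:R))) <= expR (- (10 * d%:R ^+ 2 * n%:R)) :> R.
    rewrite ler_expR lerN2 ler_pdivlMr ?mulr_gt0//; last exact: lt_le_trans NR.
    rewrite /t !exprMn rr -subr_ge0.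
    have -> : 9 ^+ 2 * d%:R ^+ 2 * (N%:R * n%:R) - 10 * d%:R ^+ 2 * n%:R * (8 * N%:R) =
      d%:R ^+ 2 * (N%:R * n%:R) :> R by ring.
    by rewrite mulr_ge0 ?sqr_ge0.
  have h2 := grid_card.
  have h3 : 16 * M%:R ^+ d * expR (- (10 * d%:R ^+ 2 * n%:R)) <= 1 :> R.
    by rewrite expRN ler_pdivrMr ?expR_gt0// mul1r.
  have -> : 2 * 2 * (M%:R ^+ d * (2 * 2) * (2 ^+ N * expR (- (t ^+ 2 / (8 * N%:R))))) =
     2 ^+ N * (16 * M%:R ^+ d * expR (- (t ^+ 2 / (8 * N%:R)))) :> R by ring.
  rewrite -[leRHS]mulr1 ler_wpM2l ?exprn_ge0//; apply: le_trans h3.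
  by rewrite ler_wpM2l// mulr_ge0// exprn_ge0.
move=> s; rewrite inE negb_exists => /forallP hs x.
have bnd b g : `|(if b then tre kap (fun i => sgb (s i)) (gridpt g)
                 else tim kap (fun i => sgb (s i)) (gridpt g))| <= t.
  have h b1 : sgb b1 * (if b then tre kap (fun i => sgb (s i)) (gridpt g)
                 else tim kap (fun i => sgb (s i)) (gridpt g)) <= t.
    have := hs (g, (b1, b)); rewrite -ltNge => /ltW; apply: le_trans.
    by rewrite /a /= radsumZ /radsum; case: b.
  have := h true; have := h false; rewrite /sgb expr0 expr1 mul1r mulN1r => h1 h2.
  by rewrite ler_norml h1 andbT lerNl.
have [g [h1 h2]] := spoly_grid s x.
apply: (le_trans (normc_le_ReIm _)) => /=.
have h3 := bnd true g; have h4 := bnd false g; rewrite /= in h3 h4.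
have h5 (u v : R) : `|u - v| <= 1 -> `|v| <= t -> `|u| <= t + 1.
  move=> uv vt; rewrite -(subrK v u) addrC; apply: (le_trans (ler_normD _ _)).
  exact: lerD.
have := h5 _ _ h1 h3; have := h5 _ _ h2 h4.
(* Here 2 (t + 1) <= 4 t, since t >= 1. *)
rewrite (_ : 36 * d%:R * r = 4 * t); last by rewrite /t; ring.
move: t1; lra.
Qed.

(** [rad_four] contributes 48 e^2 for each of the real and imaginary parts. *)
Definition cfour : R := 96 * expR 2.

Lemma fourth_ge0 s : 0 <= fourth s.
Proof. by apply: Rintegral_ge0 => x _; rewrite addr_ge0// -[4%N]/(2 * 2)%N exprM sqr_ge0. Qed.

(** After exchanging the sum over signs with the integral, [rad_four] applies at every fixed x. *)
Lemma sum_fourth : \sum_s fourth s <= cfour * N%:R ^+ 2 * 2 ^+ N.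
Proof.
have b4 s : bmeas (fun x => tre kap (fun i => sgb (s i)) x ^+ 4 + tim kap (fun i => sgb (s i)) x ^+ 4).
  by apply: bmeasD; apply: bmeasX; [exact: bmeas_tre|exact: bmeas_tim].
rewrite /fourth -bmeas_Rintegral_sum//.
rewrite -[leRHS](@Rintegral_torus_cst R d).
apply: bmeas_le_Rintegral; [exact: bmeas_sum|exact: bmeas_cst|move=> x].
rewrite big_split /=.
have h1 : \sum_(s : {ffun I -> bool}) tre kap (fun i => sgb (s i)) x ^+ 4 <= 48 * expR 2 * N%:R ^+ 2 * 2 ^+ N.
  by apply: rad_four => // i; rewrite ler_norml cos_geN1 cos_le1.
have h2 : \sum_(s : {ffun I -> bool}) tim kap (fun i => sgb (s i)) x ^+ 4 <= 48 * expR 2 * N%:R ^+ 2 * 2 ^+ N.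
  by apply: rad_four => // i; rewrite ler_norml sin_geN1 sin_le1.
apply: (le_trans (lerD h1 h2)); rewrite /cfour le_eqVlt; apply/orP; left; apply/eqP; ring.
Qed.

(** Two exceptional sets are removed, for the sup norm and for the fourth moment, each with at most
    a quarter of all sign vectors. *)
Lemma good_signs : exists G : {set {ffun I -> bool}},
  2 ^+ N <= 2 * #|G|%:R :> R /\
  forall s, s \in G -> fourth s <= 4 * cfour * N%:R ^+ 2 /\ forall x,
    Normc.normc (spoly s x) <= 36 * d%:R * Num.sqrt (N%:R * n%:R).
Proof.
have [B [hB sB]] := sup_signs.
have NR : 0 < N%:R :> R by rewrite ltr0n.
(* Four times the bound for the mean of [fourth], so that Markov's inequality leaves at most a
   quarter of the sign vectors above Q. *)
pose Q := 4 * cfour * N%:R ^+ 2.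
have Q0 : 0 < Q by rewrite /Q !mulr_gt0// ?exprn_gt0// expR_gt0.
pose F := [set s | Q < fourth s].
have hF : 4 * #|F|%:R <= 2 ^+ N :> R.
  have : #|F|%:R * Q <= \sum_s fourth s.
    rewrite mulr_natl -sumr_const [leRHS](bigID (mem F)) /= -[leLHS]addr0 lerD//.
      by apply: ler_sum => s; rewrite inE => /ltW.
    by apply: sumr_ge0 => s _; exact: fourth_ge0.
  move=> /le_trans /(_ sum_fourth).
  rewrite (_ : #|F|%:R * Q = cfour * N%:R ^+ 2 * (4 * #|F|%:R)); last by rewrite /Q; ring.
  by rewrite ler_pM2l// mulr_gt0 ?exprn_gt0// /cfour mulr_gt0// expR_gt0.
exists (~: (B :|: F)); split.
  have h1 : (#|B :|: F| <= #|B| + #|F|)%N by rewrite cardsU leq_subr.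
  have h2 : (#|B :|: F| + #|~: (B :|: F)| = 2 ^ N)%N.
    by rewrite cardsC card_ffun card_bool.
  move: h1; rewrite -(ler_nat R) natrD => h1.
  have : #|B :|: F|%:R + #|~: (B :|: F)|%:R = 2 ^+ N :> R by rewrite -natrD h2 natrX.
  lra.
move=> s; rewrite !inE negb_or -leNgt => /andP[sNB sF]; split => //.
exact: sB.
Qed.

(** The constant left in [separation]: a main term 1/16 minus a correction 1/32, in units of 1 /
    sqrt cfour. *)
Definition csep : R := 32^-1 / Num.sqrt cfour.

Lemma csep_gt0 : 0 < csep.
Proof. by rewrite divr_gt0 ?invr_gt0// sqrtr_gt0 mulr_gt0// expR_gt0. Qed.

Lemma separation s s' : injective kap ->
  fourth s <= 4 * cfour * N%:R ^+ 2 -> fourth s' <= 4 * cfour * N%:R ^+ 2 ->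
  \sum_i sgb (s i) * sgb (s' i) < N%:R / 2 :> R ->
  csep * Num.sqrt N%:R <=
    \int[mu]_x Normc.normc (tpoly kap (fun i => sgb (s i) - sgb (s' i)) x).
Proof.
move=> inj fs fs' ss'; set c := fun i => sgb (s i) - sgb (s' i).
have NR : 0 < N%:R :> R by rewrite ltr0n.
set q := Num.sqrt N%:R; have q0 : 0 < q by rewrite sqrtr_gt0.
have qN : q ^+ 2 = N%:R by rewrite sqr_sqrtr// ltW.
have K0 : 0 < cfour by rewrite mulr_gt0// expR_gt0.
set k := Num.sqrt cfour; have k0 : 0 < k by rewrite sqrtr_gt0.
have kK : k ^+ 2 = cfour by rewrite sqr_sqrtr// ltW.
have c2 : N%:R <= \sum_i c i ^+ 2.
  have -> : \sum_i c i ^+ 2 = 2 * N%:R - 2 * \sum_i sgb (s i) * sgb (s' i).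
    rewrite mulr_sumr mulr_natr -sumr_const -sumrB; apply: eq_bigr => i _.
    have := @sgbM R (s i); have := @sgbM R (s' i); rewrite /c.
    set u := sgb (s i); set v := sgb (s' i) => vv uu.
    rewrite (_ : (u - v) ^+ 2 = u * u + v * v - 2 * (u * v)); last by ring.
    rewrite uu vv; ring.
  move: ss'; lra.
have lin (f : (I -> R) -> Rd R d -> R) : (f = tre kap \/ f = tim kap) -> forall x,
    f c x = f (fun i => sgb (s i)) x - f (fun i => sgb (s' i)) x.
  by case=> -> x; rewrite -sumrB; apply: eq_bigr => i _; rewrite -mulrBl.
have p4 (u v : R) : (u - v) ^+ 4 <= 8 * (u ^+ 4 + v ^+ 4).
  have h : (u - v) ^+ 2 <= 2 * (u ^+ 2 + v ^+ 2).
    rewrite -subr_ge0 (_ : 2 * (u ^+ 2 + v ^+ 2) - (u - v) ^+ 2 = (u + v) ^+ 2) ?sqr_ge0//.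
    by ring.
  have h' : (u ^+ 2 + v ^+ 2) ^+ 2 <= 2 * (u ^+ 4 + v ^+ 4).
    rewrite -subr_ge0 (_ : 2 * (u ^+ 4 + v ^+ 4) - (u ^+ 2 + v ^+ 2) ^+ 2 = (u ^+ 2 - v ^+ 2) ^+ 2) ?sqr_ge0//.
    by ring.
  rewrite -[4%N]/(2 * 2)%N !exprM.
  have := lerXn2r 2 (sqr_ge0 (u - v)) _ h; rewrite ?nnegrE.
  rewrite -[4%N]/(2 * 2)%N !exprM in h'.
  move=> h2; apply: le_trans (h2 _) _; first by rewrite mulr_ge0 ?addr_ge0 ?sqr_ge0.
  rewrite exprMn; move: h'; lra.
have b4 (e : I -> R) : bmeas (fun x => tre kap e x ^+ 4 + tim kap e x ^+ 4).
  by apply: bmeasD; apply: bmeasX; [exact: bmeas_tre|exact: bmeas_tim].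
(* The constant is 8 (4 + 4): 8 from (u - v)^4 <= 8 (u^4 + v^4), and 4 from each fourth moment. *)
have c4 : \int[mu]_x (tre kap c x ^+ 4 + tim kap c x ^+ 4) <= 64 * cfour * N%:R ^+ 2.
  apply: (@le_trans _ _ (8 * (fourth s + fourth s'))); last first.
    move: fs fs'; lra.
  rewrite /fourth -bmeas_RintegralD// -bmeas_RintegralZ//; last exact: bmeasD.
  apply: bmeas_le_Rintegral => //.
    by apply: bmeasM; [exact: bmeas_cst|exact: bmeasD].
  move=> x; rewrite !lin; [|by right|by left].
  set u := tre _ _ _; set u' := tre _ _ _; set v := tim _ _ _; set v' := tim _ _ _.
  have := p4 u u'; have := p4 v v'; lra.
(* At the scale A = 16 k q the main term is at least N / A = q / (16 k), and the fourth moment term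
   is at most 128 k^2 q^4 / A^3 = q / (32 k). *)
have A0 : 0 < 16 * k * q by rewrite !mulr_gt0.
have h := L1_lower c inj A0.
set X := (X in _ <= X); rewrite -/X in h.
have h1 : N%:R / (16 * k * q) <= X + 2 / (16 * k * q) ^+ 3 * (64 * cfour * N%:R ^+ 2).
  apply: le_trans (_ : _ <= (\sum_i c i ^+ 2) / (16 * k * q)) _.
    by rewrite ler_wpM2r// invr_ge0 ltW.
  apply: (le_trans h); rewrite lerD2l. apply: ler_wpM2l => //.
  by apply: divr_ge0 => //; apply: exprn_ge0; exact: ltW.
move: h1; rewrite -lerBlDr; apply: le_trans.
rewrite -qN -kK /csep -/k.
rewrite (_ : _ - _ = 32^-1 / k * q)//.
by field; rewrite ?gt_eqF// k0 q0.
Qed.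

(* A class of phi containing no such pair has at most 2^N exp (- N / 32) elements. *)
Lemma pigeonhole (k : nat) (G : {set {ffun I -> bool}})
    (phi : {ffun I -> bool} -> 'I_(2 ^ k)) : (0 < k)%N -> (64 * k <= N)%N ->
  2 ^+ N <= 2 * #|G|%:R :> R ->
  exists s s', [/\ s \in G, s' \in G, phi s = phi s' &
    \sum_i sgb (s i) * sgb (s' i) < N%:R / 2 :> R].
Proof.
move=> k0 kN hG; apply: contrapT => hno.
have NR : 0 < N%:R :> R by rewrite ltr0n.
have far s s' : s \in G -> s' \in G -> phi s = phi s' ->
    N%:R / 2 <= radsum (fun i => sgb (s' i)) s :> R.
  move=> sG s'G ss'; rewrite leNgt; apply/negP => lt; apply: hno.
  by exists s, s'; split.
have hj (j : 'I_(2 ^ k)) : #|[set s in G | phi s == j]|%:R <=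
    2 ^+ N * expR (- (N%:R / 32)) :> R.
  have [->|[s']] := set_0Vmem [set s in G | phi s == j].
    by rewrite cards0 mulr_ge0 ?exprn_ge0 ?expR_ge0.
  rewrite inE => /andP[s'G /eqP s'j].
  apply: le_trans (_ : _ <= #|[set s | N%:R / 2 <= radsum (fun i => sgb (s' i)) s :> R]|%:R) _.
    rewrite ler_nat subset_leq_card//; apply/fintype.subsetP => s; rewrite !inE => /andP[sG /eqP sj].
    by apply: far => //; rewrite sj.
  have -> : N%:R / 32 = (N%:R / 2) ^+ 2 / (8 * N%:R) :> R by field; rewrite gt_eqF.
  by apply: rad_tail => // i; rewrite normr_sgb.
have hs : #|G|%:R <= 2 ^+ k * (2 ^+ N * expR (- (N%:R / 32))) :> R.
  have -> : #|G| = (\sum_(j : 'I_(2 ^ k)) #|[set s in G | phi s == j]|)%N.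
    rewrite -sum1_card (partition_big phi xpredT)//=; apply: eq_bigr => j _.
    by rewrite -sum1_card; apply: eq_bigl => s; rewrite inE.
  rewrite natr_sum -natrX mulr_natl -[in leRHS](card_ord (2 ^ k)) -sumr_const.
  exact: ler_sum.
have e2 : 2 < expR 1 :> R by apply: expR_gt1Dx; rewrite oner_eq0.
(* N >= 64 k gives exp (- N / 32) <= e^(- 2k), and 2^(k+1) <= 2^(2k) < e^(2k); hence 2^k classes
   cannot fill half of the sign vectors. *)
have h1 : expR (- (N%:R / 32)) <= (expR 1 ^+ (2 * k))^-1 :> R.
  rewrite -expRM_natl mulr1 -expRN ler_expR lerN2 ler_pdivlMr// -natrM ler_nat.
  by apply: leq_trans kN; rewrite mulnAC.
have h2 : 2 * (2 ^+ k * expR (- (N%:R / 32))) < 1 :> R.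
  apply: le_lt_trans (_ : _ <= 2 ^+ k.+1 / expR 1 ^+ (2 * k)) _.
    by rewrite mulrA -exprS ler_wpM2l ?exprn_ge0.
  rewrite ltr_pdivrMr ?exprn_gt0 ?expR_gt0// mul1r.
  apply: le_lt_trans (_ : _ <= 2 ^+ (2 * k)) _.
    by rewrite ler_eXn2l ?ltr1n// mul2n -addnn -addn1 leq_add2l.
  by rewrite ltrXn2r ?nnegrE ?expR_ge0// -lt0n muln_gt0.
have P0 : 0 < 2 ^+ N :> R by rewrite exprn_gt0.
have : 2 ^+ N * (2 * (2 ^+ k * expR (- (N%:R / 32)))) < 2 ^+ N :> R.
  by rewrite -[ltRHS]mulr1 ltr_pM2l.
move: hs hG; set E := expR _; set p := 2 ^+ N; set w := 2 ^+ k => hs hG.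
rewrite (_ : p * (2 * (w * E)) = 2 * (w * (p * E))); last by ring.
move: hs hG; lra.
Qed.

End good_signs.

(** * Entropy numbers *)

Section entropy.
Context {R : realType} (d n : nat) (I : finType) (kap : I -> d.-tuple int).
Local Notation mu := (@torus_measure R d).
Local Notation N := #|I|.

Lemma normc_tpolyZ (r : R) (c : I -> R) x : 0 <= r ->
  Normc.normc (tpoly kap (fun i => r * c i) x) = r * Normc.normc (tpoly kap c x).
Proof.
move=> r0; rewrite !normcE /=.
have -> : tre kap (fun i => r * c i) x = r * tre kap c x.
  by rewrite /tre mulr_sumr; apply: eq_bigr => i _; rewrite mulrA.
have -> : tim kap (fun i => r * c i) x = r * tim kap c x.
  by rewrite /tim mulr_sumr; apply: eq_bigr => i _; rewrite mulrA.
by rewrite !exprMn -mulrDr sqrtrM ?sqr_ge0// sqrtr_sqr ger0_norm.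
Qed.

Lemma tpolyB (c c' : I -> R) :
  (tpoly kap c : Rd R d -> R[i]) - tpoly kap c' = tpoly kap (fun i => c i - c' i).
Proof.
apply/funext => x; rewrite !fctE /tpoly.
rewrite [LHS](_ : _ = Complex (tre kap c x - tre kap c' x) (tim kap c x - tim kap c' x))//.
by congr Complex; rewrite -sumrB; apply: eq_bigr => i _; rewrite mulrBl.
Qed.

Lemma cnorm_oo_le (f : Rd R d -> R[i]) (B : R) :
  (forall x, Normc.normc (f x) <= B) -> (cnorm +oo f <= B%:E)%E.
Proof.
move=> fB; rewrite /cnorm unlock /=.
have B0 : 0 <= B.
  by apply: le_trans (fB [tuple 0 | _ < d]); rewrite normcE sqrtr_ge0.
(* The sup norm is 0 by convention on a space without positive mass; there [B0] suffices. *)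
case: ifPn => _; last by rewrite lee_fin.
apply: ess_sup_inf.ess_sup_ler => x; rewrite lee_fin ger0_norm//.
by rewrite normcE sqrtr_ge0.
Qed.

Context (d0 : (0 < d)%N) (n0 : (0 < n)%N) (inj : injective kap).
Context (N_le : (N <= 2 ^ (n * d))%N).
Context (in_layer : forall i, (\sum_(j < d) tnth (blk (kap i)) j)%N = n).

Lemma in_layer_lt i j : (`|tnth (kap i) j| < 2 ^ n)%N.
Proof.
have h : (tnth (blk (kap i)) j <= n)%N by rewrite -(in_layer i) (bigD1 j)//= leq_addr.
apply: leq_trans (_ : _ <= 2 ^ tnth (blk (kap i)) j)%N _; last by rewrite leq_exp2l.
by rewrite tnth_mktuple; exact: up_logP.
Qed.

(** Two scaled polynomials in a common ball of radius e are at L_1 distance at most 2 e, so that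
    [separation] bounds e from below. The factor sqrt N cancels, leaving the loss 1 / sqrt n; 72 is
    twice the 36 of the sup bound. *)
Lemma entropy_lower (a b : R) (k : nat) : (0 < k)%N -> (64 * k <= N)%N ->
  ((csep / (72 * d%:R) *
    (2 `^ (- (a * n%:R)) * n%:R `^ (d.-1%:R * b) / Num.sqrt n%:R))%:E <=
   entropy_number (V := Rd R d -> R[i]) (Lp 1) (cnorm 1) (Wclass a b +oo) k)%E.
Proof.
move=> k0 kN.
have N0 : (0 < N)%N by apply: leq_trans kN; rewrite muln_gt0.
have [G [hG sG]] := @good_signs R d n I kap d0 n0 N0 N_le in_layer_lt.
set r := 2 `^ _ * _; have r0 : 0 < r by rewrite mulr_gt0// powR_gt0 ?ltr0n.
set q := Num.sqrt n%:R; have q0 : 0 < q by rewrite sqrtr_gt0 ltr0n.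
set p := Num.sqrt (N%:R : R); have p0 : 0 < p by rewrite sqrtr_gt0 ltr0n.
have dR : 0 < d%:R :> R by rewrite ltr0n.
(* The sup bound of the good signs: scaling by r / t brings the sup norm down to r, the bound of the
   class in layer n. *)
pose t := 36 * d%:R * (p * q); have t0 : 0 < t by rewrite !mulr_gt0.
pose F (s : {ffun I -> bool}) : Rd R d -> R[i] := tpoly kap (fun i => r / t * sgb (s i)).
have FW s : s \in G -> Wclass a b +oo (F s).
  move=> /sG[_ hs]; split; first exact: tpoly_L1.
  move=> l; rewrite (layer_tpoly _ _ inj in_layer); case: eqVneq => [->|_]; last first.
    apply: (@le_trans _ _ 0%E); last by rewrite lee_fin mulr_ge0// powR_ge0.
    by apply: cnorm_oo_le => x; rewrite normcE /= expr0n addr0 sqrtr0.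
  rewrite (maxn_idPl n0) -/r; apply: cnorm_oo_le => x.
  rewrite normc_tpolyZ ?divr_ge0 ?(ltW r0) ?(ltW t0)//.
  rewrite mulrAC ler_pdivrMr// ler_wpM2l ?(ltW r0)//.
  by apply: (le_trans (hs x)); rewrite /t sqrtrM// ltW.
apply: le_ereal_inf_tmp => _ [e [e0 [y [yL cover]]] <-].
have /choice[phi hphi] : forall s, exists j, s \in G -> (cnorm 1 (F s - y j)%R <= e%:E)%E.
  move=> s; have [sG'|_] := boolP (s \in G).
    by have [j _ [_ hj]] := cover _ (FW s sG'); exists j.
  by exists (Ordinal (expn_gt0 2 k : 0 < 2 ^ k)%N).
have [s [s' [sG1 sG2 ss' hss']]] := pigeonhole (R := R) N0 phi k0 kN hG.
have h1 := separation N0 inj (sG _ sG1).1 (sG _ sG2).1 hss'.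
have h2 : (cnorm 1 (F s - F s')%R <= e%:E + e%:E)%E.
  apply: (le_trans (@cnorm1_triangle _ _ (F s) (F s') (y (phi s)) _ _ _)).
  - exact: cmeasurable_tpoly.
  - exact: cmeasurable_tpoly.
  - by case: (yL (phi s)).
  by apply: leeD; [exact: hphi|rewrite ss'; exact: hphi].
move: h2; rewrite tpolyB cnorm1E; last exact: bmeas_normc_tpoly.
under eq_Rintegral do under eq_fun do rewrite -mulrBr.
under eq_Rintegral do rewrite normc_tpolyZ ?divr_ge0 ?(ltW r0) ?(ltW t0)//.
rewrite bmeas_RintegralZ; last exact: bmeas_normc_tpoly.
rewrite -EFinD !lee_fin => h2.
have h3 : r / t * (csep * p) <= e + e.
  by apply: le_trans h2; rewrite ler_wpM2l// divr_ge0 ?(ltW r0) ?(ltW t0).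
have E : r / t * (csep * p) = 2 * (csep / (72 * d%:R) * (r / q)).
  by rewrite /t; field; rewrite !gt_eqF.
move: h3; rewrite E; lra.
Qed.

End entropy.

(** * Counting the frequencies of a layer *)

(** The nonnegative part of a block has 2^(s-1) integers, or one if s = 0; the factor 2 covers both
    cases. *)
Lemma card_block (n s : nat) : (s <= n)%N ->
  (2 ^ s <= 2 * #|[pred x : 'I_(2 ^ n) | up_log 2 x.+1 == s]|)%N.
Proof.
move=> sn; set A := [pred x | _].
have lt (y : 'I_(2 ^ s - 2 ^ s %/ 2)) : (2 ^ s %/ 2 + y < 2 ^ s)%N.
  by have := ltn_ord y; rewrite ltn_subRL.
have lt' (y : 'I_(2 ^ s - 2 ^ s %/ 2)) : (2 ^ s %/ 2 + y < 2 ^ n)%N.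
  by apply: (leq_trans (lt y)); rewrite leq_exp2l.
pose g y := Ordinal (lt' y).
have gi : injective g by move=> y y' /(congr1 val) /= /addnI /val_inj.
have : (#|[set g y | y in 'I_(2 ^ s - 2 ^ s %/ 2)]| <= #|A|)%N.
  apply: subset_leq_card; apply/fintype.subsetP => _ /imsetP[y _ ->].
  rewrite inE /=; apply/eqP/esym/up_log_blockE.
  by rewrite leq_addr lt.
rewrite card_imset// card_ord; move: (2 ^ s)%N => q; lia.
Qed.

Section hyperbolic_layer.
Context (d' m : nat).
(* With this n, the blocks s with s_j < m for j <> 0 and s_0 = n - sum s_j are
   already a positive proportion of all the blocks of the layer. *)
Let n := (d' * m)%N.

(** Layer n forces every coordinate below 2^n, so functions into ['I_(2 ^ n)] capture all its
    frequencies with nonnegative coordinates in a finite type. *)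
Definition in_hyp (f : {ffun 'I_d'.+1 -> 'I_(2 ^ n)}) :=
  (\sum_j up_log 2 (f j).+1 == n)%N.

Definition hyp : finType := {f : {ffun 'I_d'.+1 -> 'I_(2 ^ n)} | in_hyp f}.

Definition hypfreq (f : hyp) : d'.+1.-tuple int :=
  [tuple Posz (val f j) | j < d'.+1].

Lemma hypfreq_inj : injective hypfreq.
Proof.
move=> f f' e; apply/val_inj/ffunP => j; apply: val_inj.
by have := congr1 (fun t : d'.+1.-tuple int => tnth t j) e; rewrite !tnth_mktuple => -[].
Qed.

Lemma hypfreq_layer f : (\sum_(j < d'.+1) tnth (blk (hypfreq f)) j)%N = n.
Proof.
rewrite -[RHS](eqP (valP f)); apply: eq_bigr => j _.
by rewrite !tnth_mktuple.
Qed.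

Lemma card_hyp_le : (#|{: hyp}| <= 2 ^ (n * d'.+1))%N.
Proof.
rewrite card_sig (leq_trans (max_card _))// card_ffun !card_ord -expnM//.
Qed.

(** The m^d' choices u of blocks for the last d' coordinates give disjoint sets of frequencies, each
    with at least 2^n / 2^(d'+1) elements. *)
Lemma card_hyp_ge : (2 ^ n * m ^ d' <= 2 ^ d'.+1 * #|{: hyp}|)%N.
Proof.
(* Coordinate 0 takes the rest n - sum u; by [su] the natural subtraction does not truncate. *)
pose sh (u : {ffun 'I_d' -> 'I_m}) (j : 'I_d'.+1) : nat :=
  if unlift ord0 j is Some j' then u j' else (n - \sum_j' u j')%N.
have su (u : {ffun 'I_d' -> 'I_m}) : (\sum_j' u j' <= n)%N.
  apply: leq_trans (_ : \sum_(j' < d') m <= _)%N; last by rewrite sum_nat_const card_ord.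
  by apply: leq_sum => j _; exact: ltnW.
have shsum u : (\sum_j sh u j = n)%N.
  rewrite big_ord_recl /sh unlift_none.
  rewrite [X in (_ + X)%N](eq_bigr (fun j => u j : nat)) ?subnK// => j _.
  by rewrite liftK.
pose A u := [set f : {ffun 'I_d'.+1 -> 'I_(2 ^ n)} | [forall j, up_log 2 (f j).+1 == sh u j]].
have cA u : (2 ^ n <= 2 ^ d'.+1 * #|A u|)%N.
  have -> : #|A u| = (\prod_(j < d'.+1) #|[pred x : 'I_(2 ^ n) | up_log 2 x.+1 == sh u j]|)%N.
    transitivity #|family (fun j => [pred x : 'I_(2 ^ n) | up_log 2 x.+1 == sh u j])|.
      by apply: eq_card => f; rewrite inE; apply/forallP/familyP.
    rewrite card_family foldrE big_image; exact: eq_bigl.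
  rewrite -{1}(shsum u) expn_sum -[X in (X ^ d'.+1)%N]/2%N.
  have -> : (2 ^ d'.+1 = \prod_(j < d'.+1) 2)%N by rewrite prod_nat_const card_ord.
  rewrite -big_split /=; apply: leq_prod => j _; apply: card_block.
  by rewrite -(shsum u) (bigD1 j)//= leq_addr.
(* A frequency determines its blocks and hence u, so it is counted at most once. *)
have disj : (\sum_u #|A u| <= #|{: hyp}|)%N.
  rewrite card_sig.
  rewrite (eq_bigr (fun u => \sum_(f | f \in A u) 1)%N); last by move=> u _; rewrite sum1_card.
  rewrite (exchange_big_dep xpredT)//= -sum1_card [leqRHS]big_mkcond /=.
  apply: leq_sum => f _; under eq_bigl do rewrite inE.
  rewrite sum1_card.
  have [h|h] := boolP (f \in [pred f | in_hyp f]); last first.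
    rewrite leqn0; apply/eqP/eq_card0 => u; rewrite [LHS]unfold_in; apply/negbTE.
    apply: contra h => /forallP hu; rewrite inE; apply/eqP; apply: etrans (shsum u).
    by apply: eq_bigr => j _; exact/eqP.
  apply/card_le1P => u; rewrite unfold_in => /forallP hu u'.
  rewrite [LHS]unfold_in inE.
  apply/idP/eqP => [/forallP hu'|->]; last by apply/forallP; exact: hu.
  apply/ffunP => j; apply: val_inj.
  have := eqP (hu' (lift ord0 j)); rewrite (eqP (hu (lift ord0 j))) /sh liftK.
  by move/esym.
have : (\sum_(u : {ffun 'I_d' -> 'I_m}) 2 ^ n <= \sum_u 2 ^ d'.+1 * #|A u|)%N.
  by apply: leq_sum => u _; exact: cA.
rewrite sum_nat_const card_ffun !card_ord mulnC => /leq_trans; apply.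
by rewrite -big_distrr /= leq_mul2l disj orbT.
Qed.

End hyperbolic_layer.

(** * Comparison of logarithms and powers *)

Lemma ln2_bounds {R : realType} : 2^-1 <= ln (2 : R) <= 1.
Proof.
apply/andP; split.
  rewrite -ler_expR lnK ?posrE//.
  have := @expR_le_quad R 2^-1; rewrite ger0_norm// => /(_ (lexx _)) /le_trans; apply.
  lra.
by rewrite -ler_expR lnK ?posrE//; have := expR_ge1Dx (1 : R).
Qed.

(** The exponent r may have either sign, hence the two comparisons; together they say |ln x - ln y|
    <= ln C. *)
Lemma powR_compare {R : realType} (x y C r : R) : 0 < x -> 0 < y ->
  x <= C * y -> y <= C * x -> x `^ r <= C `^ `|r| * y `^ r.
Proof.
move=> x0 y0 xy yx.
have C0 : 0 < C by rewrite -(pmulr_lgt0 _ y0) (lt_le_trans x0).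
rewrite !/powR !gt_eqF// -expRD ler_expR -lerBlDr -mulrBr.
have h1 : ln x <= ln C + ln y by rewrite -lnM ?posrE// ler_ln ?posrE ?mulr_gt0.
have h2 : ln y <= ln C + ln x by rewrite -lnM ?posrE// ler_ln ?posrE ?mulr_gt0.
apply: (le_trans (ler_norm _)); rewrite normrM ler_wpM2l// ler_norml; lra.
Qed.

(** * Choice of the layer *)

Section hyperbolic_size.
Context (d' : nat) (d0 : (0 < d')%N).

(** Up to constants depending on d', this is 2^n n^d' for the layer n = d' m. *)
Definition hsize (m : nat) : nat := (2 ^ (d' * m) * m ^ d')%N.

(** The least m will do. It exceeds 1 because [hsize 1 = 2 ^ d'] is below K. *)
Lemma hsize_choice (K : nat) : (2 ^ d' < K)%N -> exists m : nat,
  [/\ (1 < m)%N, (K <= hsize m)%N & (hsize m.-1 < K)%N].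
Proof.
move=> hK; have K0 : (0 < K)%N by apply: leq_ltn_trans hK.
have ex : exists m, (K <= hsize m)%N.
  exists K; rewrite /hsize -[leqLHS]mul1n leq_mul// ?expn_gt0//.
  by rewrite -{1}(expn1 K) leq_pexp2l.
case: (ex_minnP ex) => m Km mmin.
have m1 : (1 < m)%N.
  case: m Km {ex mmin} => [|[|m]]//; rewrite /hsize.
    by rewrite muln0 exp0n// muln0 leqNgt K0.
  by rewrite muln1 exp1n muln1 leqNgt hK.
exists m; split => //; rewrite ltnNge; apply/negP => /mmin.
by rewrite leqNgt ltn_predL (ltn_trans _ m1).
Qed.

(** One factor 2^d' comes from m <= 2 (m - 1), the other from the exponential. *)
Lemma hsize_pred m : (1 < m)%N -> (hsize m <= 4 ^ d' * hsize m.-1)%N.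
Proof.
case: m => [|m]//= m1; rewrite /hsize mulnS expnD.
rewrite -[4%N]/(2 * 2)%N [in leqRHS]expnMn [leqRHS]mulnACA leq_mul2l -expnMn leq_exp2r//.
by apply/orP; right; rewrite mul2n -addnn -[leqLHS]add1n leq_add2r.
Qed.

End hyperbolic_size.

(** * From the bound in a layer to a bound in k *)

Theorem theorem1p5 (R : realType) (d : nat) (a b : R) (hd : (2 <= d)%N) :
  exists c : R, 0 < c /\ forall k : nat, (2 <= k)%N ->
    ((c * (k%:R `^ (- a) * ln k%:R `^ (d.-1%:R * (a + b) - 2^-1)))%:E <=
     entropy_number (V := Rd R d -> R[i])
       (Lp 1) (cnorm 1) (Wclass a b +oo) k)%E.
Proof.
case: d hd => [|d']// d0; rewrite ltnS in d0.
(* K is 64 times 2^(d'+1): by [card_hyp_ge], hsize m >= K k then yields the 64 k frequencies that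
   the pigeonhole needs. *)
pose K : nat := (2 ^ (7 + d'))%N.
have K0 : 0 < K%:R :> R by rewrite ltr0n expn_gt0.
pose r1 := - a; pose r2 := d'%:R * (a + b) - 2^-1.
pose C1 : R := 4 ^+ d' * K%:R; pose C2 : R := 4 * (8 + d')%:R.
have dR : 1 <= d'%:R :> R by rewrite ler1n.
(* The power of d' comes from n = d' m, when n^(d' b - 1/2) is rewritten in terms of m. *)
pose c0 : R := csep / (72 * d'.+1%:R) * d'%:R `^ (d'%:R * b - 2^-1).
have c00 : 0 < c0.
  by rewrite mulr_gt0 ?powR_gt0 ?(lt_le_trans ltr01 dR)// divr_gt0 ?csep_gt0// mulr_gt0.
have C10 : 0 < C1 by rewrite mulr_gt0// exprn_gt0.
have C20 : 0 < C2 by rewrite mulr_gt0// ltr0n.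
exists (c0 / (C1 `^ `|r1| * C2 `^ `|r2|)); split.
  by rewrite divr_gt0// mulr_gt0// powR_gt0.
move=> k k2.
have [|m [m1 hm hm']] := @hsize_choice d' d0 (K * k).
  rewrite /K -[ltnLHS]muln1 ltn_mul// ?(ltn_trans _ k2)//.
  by rewrite ltn_exp2l// addnC -addn1 leq_add2l.
have kR : 2 <= k%:R :> R by rewrite ler_nat.
have kp : 0 < k%:R :> R by rewrite ltr0n (ltn_trans _ k2).
have mR : 2 <= m%:R :> R by rewrite ler_nat.
have mp : 0 < m%:R :> R by rewrite ltr0n (ltn_trans _ m1).
have /andP[l2 l2'] := @ln2_bounds R.
have lnk : ln 2 <= ln k%:R :> R by rewrite ler_ln ?posrE.
have lnk0 : 0 < ln k%:R :> R by rewrite (lt_le_trans _ lnk)// (lt_le_trans _ l2).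
pose W : R := (hsize d' m)%:R.
have WE : W = 2 `^ (d' * m)%:R * m%:R ^+ d' by rewrite /W /hsize natrM !natrX powR_mulrn.
have W0 : 0 < W by rewrite WE mulr_gt0 ?powR_gt0 ?exprn_gt0.
have hkW : k%:R <= C1 * W.
  apply: (@le_trans _ _ W).
    by rewrite ler_nat (leq_trans _ hm)// leq_pmull// expn_gt0.
  rewrite ler_peMl ?(ltW W0)// /C1 -natrX -natrM ler1n muln_gt0 !expn_gt0//.
have hWk : W <= C1 * k%:R.
  rewrite /C1 -natrX -!natrM ler_nat -mulnA (leq_trans (hsize_pred d0 m1))//.
  by rewrite leq_mul2l ltnW ?orbT.
(* Use ln W = d' m ln 2 + d' ln m <= 2 d' m. *)
have lnup : ln k%:R <= C2 * m%:R.
  have : ln k%:R <= ln W.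
    rewrite ler_ln ?posrE// ler_nat (leq_trans _ hm)// leq_pmull// expn_gt0//.
  move=> /le_trans; apply.
  rewrite WE lnM ?posrE ?powR_gt0 ?exprn_gt0// ln_powR lnXn//.
  have lm : ln m%:R <= m%:R :> R.
    by rewrite -ler_expR lnK ?posrE//; apply: le_trans (expR_ge1Dx _); rewrite lerDr.
  rewrite natrM -[ln m%:R *+ d']mulr_natl.
  have h1 : d'%:R * m%:R * ln 2 <= d'%:R * m%:R :> R by rewrite ler_piMr// mulr_ge0.
  have h2 : d'%:R * ln m%:R <= d'%:R * m%:R :> R by rewrite ler_wpM2l.
  have h3 := mulr_ge0 (ler0n R d') (ltW mp).
  apply: (le_trans (lerD h1 h2)); rewrite /C2 natrD mulrDr mulrDl -!mulrA; lra.
(* Minimality of m gives 2^(m-1) <= hsize (m-1) < K k. The 4 in C2 comes from ln 2 >= 1/2 and m <= 2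
   (m-1), and ln 2 <= ln k absorbs ln K. *)
have lnlo : m%:R <= C2 * ln k%:R.
  have h1 : 2 ^+ m.-1 <= K%:R * k%:R :> R.
    rewrite -natrX -natrM ler_nat (leq_trans _ (ltnW hm'))// /hsize.
    apply: leq_trans (leq_pmulr _ _); last by rewrite expn_gt0 -subn1 subn_gt0 m1.
    by rewrite leq_exp2l// leq_pmull.
  have h2 : m.-1%:R * ln 2 <= (7 + d')%:R * ln 2 + ln k%:R :> R.
    move: h1; rewrite -ler_ln ?posrE ?exprn_gt0 ?mulr_gt0// lnM ?posrE//.
    by rewrite /K natrX !lnXn// !mulr_natl.
  have h3 : (7 + d')%:R * ln 2 <= (7 + d')%:R * ln k%:R :> R by rewrite ler_wpM2l.
  have h4 : m%:R <= 2 * m.-1%:R :> R.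
    by rewrite -natrM ler_nat; case: (m) m1 => [|[|p]] //= _; rewrite mul2n -addnn addSn ltnS leq_addl.
  have h5 : m%:R * 2^-1 <= m%:R * ln 2 :> R by rewrite ler_wpM2l.
  have h6 : m%:R * ln 2 <= 2 * m.-1%:R * ln 2 :> R.
    by rewrite ler_wpM2r// (le_trans _ l2).
  have -> : C2 * ln k%:R = 4 * ((7 + d')%:R * ln k%:R + ln k%:R).
    by rewrite /C2 -[(8 + d')%N]/(1 + (7 + d'))%N natrD; ring.
  rewrite -mulrA in h6; lra.
have pw1 := powR_compare r1 kp W0 hkW hWk.
have pw2 := powR_compare r2 lnk0 mp lnup lnlo.
have n0 : (0 < d' * m)%N by rewrite muln_gt0 d0 (ltn_trans _ m1).
have N_ge : (64 * k <= #|hyp d' m|)%N.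
  rewrite -(@leq_pmul2l (2 ^ d'.+1)) ?expn_gt0//.
  apply: leq_trans (card_hyp_ge d' m); apply: leq_trans hm.
  by rewrite mulnA leq_mul// /K -[64%N]/(2 ^ 6)%N -expnD leq_exp2l// addSn addnC.
have H := @entropy_lower R d'.+1 (d' * m) (hyp d' m) (@hypfreq d' m) (ltn0Sn _) n0
  (@hypfreq_inj d' m) (card_hyp_le d' m) (@hypfreq_layer d' m) a b k (ltnW k2) N_ge.
apply: le_trans H; rewrite lee_fin /=.
apply: (@le_trans _ _ (c0 * (W `^ r1 * m%:R `^ r2))).
  rewrite -mulrA ler_wpM2l ?(ltW c00)// mulrC ler_pdivrMr ?mulr_gt0 ?powR_gt0//.
  apply: le_trans (ler_pM _ _ pw1 pw2) _; rewrite ?powR_ge0//.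
  by rewrite mulrACA mulrC.
(* What remains is an identity: W^(-a) = 2^(-an) m^(-d' a), and the exponents of m add up to d' b -
   1/2. *)
rewrite /c0 -mulrA ler_wpM2l ?divr_ge0 ?(ltW csep_gt0)// le_eqVlt; apply/orP; left; apply/eqP.
have dp : 0 < d'%:R :> R by rewrite ltr0n.
have lW : ln W = d'%:R * m%:R * ln 2 + d'%:R * ln m%:R.
  by rewrite WE lnM ?posrE ?powR_gt0 ?exprn_gt0// ln_powR lnXn// natrM -[ln m%:R *+ d']mulr_natl.
rewrite -powR12_sqrt// -powRN natrM /powR !gt_eqF ?mulr_gt0// -!expRD; congr expR.
by rewrite lW lnM ?posrE// /r1 /r2; ring.
Qed.
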